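(* For all positive integers $k,m,r$, $$W_m(k+r-1,r)+(-1)^r W_k(m+r-1,r)=\sum_{j=1}^{r-1}(-1)^{j-1}\,T(\{1\}_{k-2},\bar 1,\{1\}_{j-1},\bar 1)\,T(\{1\}_{m-2},\bar 1,\{1\}_{r-j-1},\bar 1),$$ where by convention the string $(\{1\}_{-1},\bar 1)$ is empty (so for $k=1$ the first factor is $T(\{1\}_{j-1},\bar 1)$, and similarly for $m=1$).
   Context: $\{1\}_a$ denotes the sequence of $a$ ones. For positive integers $k_1,\dots,k_r$, where some entries may be marked with a bar, $T(\ldots)$ denotes $2^r\sum_{0<n_1<\cdots<n_r}\frac{\prod_{j\text{ barred}}(-1)^{n_j}}{(2n_1-1)^{k_1}(2n_2-2)^{k_2}\cdots(2n_r-r)^{k_r}}$. The alternating multiple $T$-value is $\bar T(k_1,\dots,k_r):=T(k_1,\dots,k_{r-1},\overline{k_r})$ (only the last entry barred), with $\bar T(\emptyset):=1$. $I(k,r)$ denotes the set of tuples $(k_1,\dots,k_r)$ of positive integers with $k_1+\cdots+k_r=k$. For a positive integer $m$, $W_m(k,r):=\sum_{(k_1,\dots,k_r)\in I(k,r)}\binom{k_r+m-2}{m-1}\bar T(k_1,\ldots,k_{r-1},k_r+m-1)$. *)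

(* Defs.v *)
From Stdlib Require Import Reals List Arith.
From Coquelicot Require Import Coquelicot.
Import ListNotations.
Open Scope R_scope.

(* An entry of a T-value: (exponent k_j, barred?). *)
Definition entry := (nat * bool)%type.

Definition sgn (b : bool) (n : nat) : R := if b then (-1) ^ n else 1.

Definition lsum (f : nat -> R) (l : list nat) : R :=
  fold_right (fun i acc => f i + acc) 0 l.

(* Nested truncated sum, on the REVERSED list of entries:
   Gtrunc [(k_r,b_r); ...; (k_1,b_1)] N
     = sum_{0<n_1<...<n_r<N} prod_j sgn(b_j,n_j) / (2 n_j - j)^{k_j}. *)
Fixpoint Gtrunc (l : list entry) (N : nat) : R :=
  match l with
  | [] => 1
  | (k, b) :: l' =>
      lsum (fun n => sgn b n / (2 * INR n - INR (length l)) ^ k * Gtrunc l' n)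
           (seq 1 (N - 1))
  end.

(* Multiple T-value T(k_1,...,k_r) with bars, defined as the limit of the
   truncated sums over n_r < N (the standard meaning of these conditionally
   convergent series). *)
Definition Tval (l : list entry) : R :=
  2 ^ length l * real (Lim_seq (fun N => Gtrunc (rev l) N)).

Definition Tbar (ks : list nat) : R :=
  match ks with
  | [] => 1
  | _ => Tval (map (fun k => (k, false)) (removelast ks) ++ [(last ks 0%nat, true)])
  end.

Fixpoint comps (k r : nat) : list (list nat) :=
  match r with
  | O => if Nat.eqb k 0 then [[]] else []
  | S r' => flat_map (fun a => map (cons a) (comps (k - a) r')) (seq 1 k)
  end.

Definition W (m k r : nat) : R :=
  fold_right (fun ks acc =>
     let kr := last ks 0%nat in
     Binomial.C (kr + m - 2) (m - 1) * Tbar (removelast ks ++ [(kr + m - 1)%nat]) + acc)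
   0 (comps k r).

Definition pre (k : nat) : list entry :=
  if Nat.eqb k 1 then [] else repeat (1%nat, false) (k - 2) ++ [(1%nat, true)].

Definition Aseq (k j : nat) : list entry :=
  pre k ++ repeat (1%nat, false) (j - 1) ++ [(1%nat, true)].

(* Main.v *)
Require Import Defs.
From Stdlib Require Import Reals List Arith Lra Lia.
From Coquelicot Require Import Coquelicot.
Import ListNotations.
Open Scope R_scope.

(* Put [A_l(t) = 2^r sum_n (...) t^(2 n_r - r)], the power series whose value at
   [t = 1] is the T-value of the entries [l].  Up to sign it is an iterated integral
   of [dt / t], [2 dt / (1 - t^2)] and [rho dt = 2 dt / (1 + t^2)].  With
   [ell_j = (- ln t)^j / j!], collecting all words with given numbers of letters gives
   [(-1)^r W_m(k+r-1, r) = int_0^1 U^k_(r-1) ell_(m-1) rho dt], where [U^k_p] is the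
   [p]-fold primitive from [0] of [ell_(k-1)] with respect to [rho dt].  The involution
   [t -> (1 - t) / (1 + t)] preserves [rho dt] up to sign and exchanges [dt / t] with
   [2 dt / (1 - t^2)], so the values [(-1)^j T({1}_(k-2), bar 1, {1}_(j-1), bar 1)] are
   the values at [0] of the [j]-fold primitives [V^k_j] from [1] of the same [ell_(k-1)].
   The identity is then repeated integration by parts.  Integrals are avoided: a
   combination of these functions has zero derivative on ]0, 1[, and its limits at [0]
   and [1] (by Abel's theorem) are the two sides. *)

(** * Truncated sums as partial sums of coefficients *)

Definition pos_entries (l : list entry) : Prop := List.Forall (fun e => (1 <= fst e)%nat) l.

(* Entries are listed in reverse order (last one first), as in [Gtrunc], and the
   summation index is shifted to [m = n - length l], so [2 n - r] becomes [2 m + r]. *)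
Fixpoint coef (l : list entry) (m : nat) : R :=
  match l with
  | [] => if Nat.eqb m 0 then 1 else 0
  | (k, b) :: l' =>
      sgn b (m + S (length l')) / (2 * INR m + INR (S (length l'))) ^ k
      * sum_n (coef l') m
  end.

Lemma sum_n_succ (a : nat -> R) (n : nat) : sum_n a (S n) = sum_n a n + a (S n).
Proof. exact (sum_Sn a n). Qed.

Lemma sum_n_zero (a : nat -> R) : sum_n a 0 = a 0%nat.
Proof. exact (sum_O a). Qed.

Lemma sum_coef_nil (n : nat) : sum_n (coef []) n = 1.
Proof.
  induction n as [|n IH].
  - rewrite sum_n_zero. reflexivity.
  - rewrite sum_n_succ, IH. simpl. lra.
Qed.

Lemma lsum_app (f : nat -> R) (l1 l2 : list nat) :
  lsum f (l1 ++ l2) = lsum f l1 + lsum f l2.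
Proof.
  induction l1 as [|x l1 IH]; simpl.
  - lra.
  - unfold lsum in *. simpl. rewrite IH. lra.
Qed.

Lemma lsum_ext (f g : nat -> R) (l : list nat) :
  (forall x, In x l -> f x = g x) -> lsum f l = lsum g l.
Proof.
  induction l as [|x l IH]; intros H; unfold lsum in *; simpl.
  - reflexivity.
  - rewrite (H x) by now left. rewrite IH; [reflexivity|].
    intros y Hy. apply H. now right.
Qed.

Lemma lsum_zero (f : nat -> R) (l : list nat) :
  (forall x, In x l -> f x = 0) -> lsum f l = 0.
Proof.
  induction l as [|x l IH]; intros H; unfold lsum in *; simpl.
  - reflexivity.
  - rewrite (H x) by now left. rewrite IH; [lra|].
    intros y Hy. apply H. now right.
Qed.

Lemma lsum_seq (f : nat -> R) (s n : nat) :
  lsum f (seq s (S n)) = sum_n (fun i => f (i + s)%nat) n.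
Proof.
  induction n as [|n IH].
  - rewrite sum_n_zero. unfold lsum. simpl. lra.
  - rewrite seq_S, lsum_app, IH, sum_n_succ. unfold lsum. simpl.
    replace (s + S n)%nat with (S (n + s)) by lia. lra.
Qed.

(** Below [n] there is no room for [length l] increasing positive indices. The empty list is
    excluded because its sum is 1. *)
Lemma Gtrunc_small (l : list entry) (n : nat) :
  l <> [] -> (n <= length l)%nat -> Gtrunc l n = 0.
Proof.
  revert n. induction l as [|[k b] l IH]; intros n Hl Hn; [easy|].
  simpl Gtrunc. apply lsum_zero. intros x Hx. apply in_seq in Hx.
  simpl in Hn. rewrite IH; [ring| |lia].
  intros ->. simpl in Hn. lia.
Qed.

Lemma Gtrunc_coef (l : list entry) (n : nat) :
  Gtrunc l (n + S (length l)) = sum_n (coef l) n.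
Proof.
  revert n. induction l as [|[k b] l IH]; intros n.
  - now rewrite sum_coef_nil.
  - change (Gtrunc ((k, b) :: l) (n + S (length ((k, b) :: l)))) with
      (lsum (fun i => sgn b i / (2 * INR i - INR (S (length l))) ^ k * Gtrunc l i)
         (seq 1 (n + S (S (length l)) - 1))).
    replace (n + S (S (length l)) - 1)%nat with (length l + S n)%nat by lia.
    (* The outer indices up to [length l] contribute 0, because the inner sum is still empty there.
       The index shift removes exactly these terms. *)
    rewrite seq_app, lsum_app, lsum_zero, lsum_seq, Rplus_0_l.
    + apply sum_n_ext. intros i. cbn [coef].
      replace (i + (1 + length l))%nat with (i + S (length l))%nat by lia.
      rewrite IH. f_equal. f_equal. f_equal. rewrite plus_INR. ring.
    + intros x Hx. apply in_seq in Hx.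
      rewrite (Gtrunc_small l x); [ring| |lia].
      intros ->. simpl in Hx. lia.
Qed.

(** * Growth of the coefficients and radius of convergence *)

Lemma sgn_abs (b : bool) (n : nat) : Rabs (sgn b n) = 1.
Proof.
  destruct b; simpl.
  - apply pow_1_abs.
  - apply Rabs_R1.
Qed.

Lemma sqrt_S_pos (n : nat) : 0 < sqrt (INR (S n)).
Proof. apply sqrt_lt_R0, lt_0_INR. lia. Qed.

Lemma sqrt_S_sqr (n : nat) : sqrt (INR (S n)) * sqrt (INR (S n)) = INR (S n).
Proof. apply sqrt_sqrt, pos_INR. Qed.

(* The bounds [C / sqrt m] for the terms and [2 C sqrt m] for their partial sums
   reproduce themselves at each step of the nesting. *)
Lemma sum_n_sqrt_bound (a : nat -> R) (C : R) :
  0 <= C -> (forall m, Rabs (a m) <= C / sqrt (INR (S m))) ->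
  forall m, Rabs (sum_n a m) <= 2 * C * sqrt (INR (S m)).
Proof.
  intros HC H m. induction m as [|m IH].
  - rewrite sum_n_zero. specialize (H 0%nat). simpl in *. rewrite sqrt_1 in *. lra.
  - rewrite sum_n_succ.
    eapply Rle_trans; [apply Rabs_triang|].
    specialize (H (S m)).
    pose proof (sqrt_S_pos m) as P1. pose proof (sqrt_S_pos (S m)) as P2.
    pose proof (sqrt_S_sqr m) as Q1. pose proof (sqrt_S_sqr (S m)) as Q2.
    rewrite (S_INR (S m)) in Q2 at 3.
    set (x := sqrt (INR (S m))) in *. set (y := sqrt (INR (S (S m)))) in *.
    (* With [y^2 = x^2 + 1], the inequality [1 <= 2 (y - x) y] is [(y - x)^2 >= 0] rearranged. *)
    assert (E : C / y <= 2 * C * (y - x)).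
    { apply Rmult_le_reg_r with y; [easy|].
      replace (C / y * y) with C by (field; lra).
      assert (1 <= 2 * (y - x) * y) by (pose proof (Rle_0_sqr (y - x)); unfold Rsqr in *; lra).
      nra. }
    lra.
Qed.

Lemma denom_ge (m p : nat) : INR (S m) <= 2 * INR m + INR (S p).
Proof. rewrite !S_INR. pose proof (pos_INR m). pose proof (pos_INR p). lra. Qed.

Lemma inv_denom_pow (m p k : nat) :
  (1 <= k)%nat ->
  0 < / (2 * INR m + INR (S p)) ^ k <= / INR (S m).
Proof.
  intros Hk. pose proof (denom_ge m p) as D.
  assert (H1 : 1 <= INR (S m)) by (rewrite S_INR; pose proof (pos_INR m); lra).
  split.
  - apply Rinv_0_lt_compat, pow_lt. lra.
  - apply Rinv_le_contravar; [lra|].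
    eapply Rle_trans; [exact D|].
    rewrite <- (pow_1 (2 * INR m + INR (S p))) at 1.
    apply Rle_pow; [lra|easy].
Qed.

(** Nested sums with exponents 1 can produce powers of [ln m] over [m]. The weaker exponent 1/2
    absorbs these logarithms and keeps the same shape at every depth. *)
Lemma coef_bound (l : list entry) :
  pos_entries l ->
  exists C, 0 <= C /\ forall m, Rabs (coef l m) <= C / sqrt (INR (S m)).
Proof.
  induction l as [|[k b] l IH]; intros Hl.
  - exists 1. split; [lra|]. intros [|m]; simpl coef.
    + simpl. rewrite sqrt_1, Rabs_R1. lra.
    + rewrite Rabs_R0. apply Rlt_le, Rdiv_lt_0_compat; [lra|apply sqrt_S_pos].
  - apply Forall_cons_iff in Hl. destruct Hl as [Hk Hl]. cbn [fst] in Hk.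
    destruct (IH Hl) as [C [HC H]].
    exists (2 * C). split; [lra|]. intros m. cbn [coef].
    pose proof (sum_n_sqrt_bound _ _ HC H m) as HS.
    unfold Rdiv at 1. rewrite !Rabs_mult, sgn_abs, Rmult_1_l.
    destruct (inv_denom_pow m (length l) k Hk) as [I1 I2].
    rewrite (Rabs_pos_eq _ (Rlt_le _ _ I1)).
    apply Rle_trans with (/ INR (S m) * (2 * C * sqrt (INR (S m)))).
    + apply Rmult_le_compat; try easy; [lra|apply Rabs_pos].
    + right. rewrite <- (sqrt_S_sqr m) at 1. field.
      pose proof (sqrt_S_pos m). lra.
Qed.

Lemma CV_radius_ge_1 (a : nat -> R) (M : R) :
  (forall m, Rabs (a m) <= M) -> Rbar_le 1 (CV_radius a).
Proof.
  intros H. apply (proj1 (CV_radius_bounded a)).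
  exists M. intros n. now rewrite pow1, Rmult_1_r.
Qed.

Lemma coef_bounded (l : list entry) :
  pos_entries l -> exists M, forall m, Rabs (coef l m) <= M.
Proof.
  intros Hl. destruct (coef_bound l Hl) as [C [HC H]].
  exists C. intros m. eapply Rle_trans; [apply H|].
  pose proof (sqrt_S_pos m) as P. pose proof (sqrt_S_sqr m) as Q.
  assert (1 <= sqrt (INR (S m))).
  { rewrite <- sqrt_1. apply sqrt_le_1; [lra|apply pos_INR|].
    rewrite S_INR. pose proof (pos_INR m). lra. }
  apply Rmult_le_reg_r with (sqrt (INR (S m))); [easy|].
  unfold Rdiv. rewrite Rmult_assoc, Rinv_l by lra. nra.
Qed.

Lemma radius_lt (a : nat -> R) (u : R) :
  Rbar_le 1 (CV_radius a) -> Rabs u < 1 -> Rbar_lt (Rabs u) (CV_radius a).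
Proof. intros H Hu. eapply Rbar_lt_le_trans; [|exact H]. exact Hu. Qed.

Lemma coef_radius (l : list entry) : pos_entries l -> Rbar_le 1 (CV_radius (coef l)).
Proof. intros Hl. destruct (coef_bounded l Hl) as [M H]. now apply CV_radius_ge_1 with M. Qed.

(** * Differential equations satisfied by the series *)

(** Termwise differentiation of [t^(2m+p+1)]. Convergence of the differentiated series is recorded
    as well, since [PSeries_partial_sums] is later applied to it. *)
Lemma is_derive_pow_PSeries (a : nat -> R) (p : nat) (t : R) :
  Rbar_le 1 (CV_radius a) -> 0 < t < 1 ->
  is_derive (fun t => t ^ S p * PSeries a (t ^ 2)) t
    (t ^ p * PSeries (fun m => (2 * INR m + INR (S p)) * a m) (t ^ 2)) /\
  ex_pseries (fun m => (2 * INR m + INR (S p)) * a m) (t ^ 2).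
Proof.
  intros Ha Ht.
  assert (Hu : Rabs (t ^ 2) < 1) by (rewrite Rabs_pos_eq; nra).
  (* These are the coefficients of [2 u a'(u) + (p + 1) a(u)] at [u = t^2], as produced by the
     product and chain rules. *)
  set (b := PS_plus (PS_scal 2 (PS_incr_1 (PS_derive a))) (PS_scal (INR (S p)) a)).
  assert (Hb : forall m, b m = (2 * INR m + INR (S p)) * a m).
  { intros [|m]; unfold b, PS_plus, PS_scal, PS_incr_1, PS_derive, scal, plus, zero;
      simpl; unfold mult; simpl; ring. }
  assert (He : forall u, Rabs u < 1 ->
    ex_pseries (PS_scal 2 (PS_incr_1 (PS_derive a))) u /\
    ex_pseries (PS_scal (INR (S p)) a) u).
  { intros u H. split; apply ex_pseries_scal; try apply Rmult_comm.
    - apply ex_pseries_incr_1, CV_radius_inside. rewrite CV_radius_derive.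
      now apply radius_lt.
    - now apply CV_radius_inside, radius_lt. }
  split.
  - rewrite <- (PSeries_ext _ _ _ Hb). unfold b.
    rewrite PSeries_plus by now apply He.
    rewrite !PSeries_scal, PSeries_incr_1.
    pose proof (is_derive_PSeries a (t ^ 2) (radius_lt _ _ Ha Hu)) as D.
    assert (D2 : is_derive (fun t => t ^ 2) t (2 * t)) by (auto_derive; [easy|ring]).
    pose proof (is_derive_comp _ _ _ _ _ D D2) as D3.
    assert (D4 : is_derive (fun t => t ^ S p) t (INR (S p) * t ^ p)).
    { apply is_derive_Reals, (derivable_pt_lim_pow t (S p)). }
    pose proof (is_derive_mult _ _ _ _ _ D4 D3 Rmult_comm) as D5.
    eapply is_derive_ext; [|eapply eq_rect; [exact D5|]].
    + reflexivity.
    + unfold plus, mult, scal; simpl; unfold mult; simpl. ring.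
  - apply (ex_pseries_ext _ _ _ Hb).
    apply ex_pseries_plus; now apply He.
Qed.

(** Multiplication by [1 - u] takes differences of consecutive coefficients, which turns partial
    sums back into terms. *)
Lemma PSeries_partial_sums (a : nat -> R) (u : R) :
  ex_pseries (sum_n a) u -> (1 - u) * PSeries (sum_n a) u = PSeries a u.
Proof.
  intros H.
  rewrite (PSeries_ext a (PS_minus (sum_n a) (PS_incr_1 (sum_n a)))).
  - rewrite PSeries_minus; [|easy|now apply ex_pseries_incr_1].
    rewrite PSeries_incr_1. ring.
  - intros [|n]; unfold PS_minus, PS_plus, PS_opp, PS_incr_1, plus, opp, zero; simpl.
    + rewrite sum_n_zero. ring.
    + rewrite sum_n_succ. ring.
Qed.

Lemma PSeries_alternate (a : nat -> R) (c u : R) :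
  PSeries (fun m => c * (-1) ^ m * a m) u = c * PSeries a (- u).
Proof.
  rewrite <- PSeries_scal. apply Series_ext. intros n.
  unfold PS_scal, scal; simpl; unfold mult; simpl.
  replace (- u) with (-1 * u) by ring. rewrite Rpow_mult_distr. ring.
Qed.

Definition Afun (l : list entry) (t : R) : R :=
  2 ^ length l * (t ^ length l * PSeries (coef l) (t ^ 2)).

(** Toggles the bar of the last entry. Its sign depends on the summation index alone, so toggling it
    replaces [t^2] by [- t^2] in the series, up to a global sign. *)
Definition flip (l : list entry) : list entry :=
  match l with
  | [] => []
  | (k, b) :: l' => (k, negb b) :: l'
  end.

Lemma pos_entries_flip (l : list entry) : pos_entries l -> pos_entries (flip l).
Proof.
  destruct l as [|[k b] l]; [easy|]. intros H.
  apply Forall_cons_iff in H. now apply Forall_cons_iff.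
Qed.

Lemma length_flip (l : list entry) : length (flip l) = length l.
Proof. now destruct l as [|[k b] l]. Qed.

Lemma sqr_pow_minus_one (n : nat) : (-1) ^ n * (-1) ^ n = 1.
Proof. rewrite <- Rpow_mult_distr. replace (-1 * -1) with 1 by ring. apply pow1. Qed.

Lemma coef_flip (l : list entry) (m : nat) :
  coef (flip l) m = (-1) ^ length l * (-1) ^ m * coef l m.
Proof.
  destruct l as [|[k b] l].
  - destruct m; simpl; ring.
  - cbn [flip coef length].
    rewrite <- pow_add, (Nat.add_comm (S (length l)) m).
    destruct b; cbn [negb sgn].
    + unfold Rdiv. rewrite <- !Rmult_assoc, sqr_pow_minus_one. ring.
    + unfold Rdiv. ring.
Qed.

Lemma PSeries_coef_flip (l : list entry) (u : R) :
  PSeries (coef (flip l)) u = (-1) ^ length l * PSeries (coef l) (- u).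
Proof. rewrite <- PSeries_alternate. apply PSeries_ext, coef_flip. Qed.

Lemma denom_neq0 (m p : nat) : 2 * INR m + INR (S p) <> 0.
Proof. pose proof (denom_ge m p). pose proof (lt_0_INR (S m) ltac:(lia)). lra. Qed.

(** Common start of the three rules below: differentiation cancels one factor of the outer
    denominator, and each rule then identifies [c]. *)
Lemma is_derive_Afun_cons (k : nat) (b : bool) (l : list entry) (t : R) :
  pos_entries l -> 0 < t < 1 ->
  let c := fun m => (2 * INR m + INR (S (length l))) * coef ((S k, b) :: l) m in
  is_derive (Afun ((S k, b) :: l)) t
    (2 ^ S (length l) * (t ^ length l * PSeries c (t ^ 2))) /\
  ex_pseries c (t ^ 2).
Proof.
  intros Hl Ht c.
  assert (Hp : pos_entries ((S k, b) :: l)) by (apply Forall_cons_iff; split; simpl; [lia|easy]).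
  destruct (is_derive_pow_PSeries _ (length l) t (coef_radius _ Hp) Ht) as [D E].
  split; [|exact E].
  apply (is_derive_scal _ _ (2 ^ S (length l)) _ D).
Qed.

Lemma is_derive_Afun_SS (k : nat) (b : bool) (l : list entry) (t : R) :
  pos_entries l -> 0 < t < 1 ->
  is_derive (Afun ((S (S k), b) :: l)) t (Afun ((S k, b) :: l) t / t).
Proof.
  intros Hl Ht. destruct (is_derive_Afun_cons (S k) b l t Hl Ht) as [D _].
  eapply eq_rect; [exact D|].
  unfold Afun. cbn [length].
  rewrite (PSeries_ext _ (coef ((S k, b) :: l))).
  - simpl. field. lra.
  - intros n. cbn [coef]. pose proof (denom_neq0 n (length l)) as N.
    set (x := 2 * INR n + INR (S (length l))) in *.
    change (x ^ S (S k)) with (x * x ^ S k).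
    field. split; [apply pow_nonzero|]; easy.
Qed.

(** No outer denominator is left, so [c] is the sequence of partial sums of the inner coefficients,
    whose generating series carries the factor [1 / (1 - t^2)]. *)
Lemma is_derive_Afun_1_false (l : list entry) (t : R) :
  pos_entries l -> 0 < t < 1 ->
  is_derive (Afun ((1%nat, false) :: l)) t (2 / (1 - t ^ 2) * Afun l t).
Proof.
  intros Hl Ht. destruct (is_derive_Afun_cons 0 false l t Hl Ht) as [D E].
  set (c := fun _ => _) in *.
  assert (Hc : forall m, c m = sum_n (coef l) m).
  { intros m. unfold c. cbn [coef sgn]. field. apply denom_neq0. }
  eapply eq_rect; [exact D|].
  rewrite (PSeries_ext _ _ _ Hc).
  unfold Afun. rewrite <- (PSeries_partial_sums (coef l) (t ^ 2)).
  - simpl. field. nra.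
  - exact (ex_pseries_ext _ _ _ Hc E).
Qed.

(** As in the unbarred case, but the alternating sign evaluates the series of partial sums at
    [- t^2]. This gives [1 / (1 + t^2)] and flips the bar of the inner list. *)
Lemma is_derive_Afun_1_true (l : list entry) (t : R) :
  pos_entries l -> 0 < t < 1 ->
  is_derive (Afun ((1%nat, true) :: l)) t (- (2 / (1 + t ^ 2)) * Afun (flip l) t).
Proof.
  intros Hl Ht. destruct (is_derive_Afun_cons 0 true l t Hl Ht) as [D E].
  set (c := fun _ => _) in *.
  assert (Hc : forall m, c m = (-1) ^ S (length l) * (-1) ^ m * sum_n (coef l) m).
  { intros m. unfold c. cbn [coef sgn]. rewrite pow_add. field. apply denom_neq0. }
  eapply eq_rect; [exact D|].
  rewrite (PSeries_ext _ _ _ Hc), PSeries_alternate.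
  unfold Afun. rewrite PSeries_coef_flip, length_flip.
  rewrite <- (PSeries_partial_sums (coef l) (- t ^ 2)).
  - simpl. field. nra.
  - eapply ex_series_ext;
      [|exact (ex_pseries_scal ((-1) ^ S (length l)) c (t ^ 2) (Rmult_comm _ _) E)].
    intros n. unfold PS_scal. rewrite Hc. generalize (sum_n (coef l) n : R). intros s.
    unfold scal; simpl; unfold mult; simpl.
    rewrite !pow_n_pow. replace (- (t * (t * 1))) with (-1 * (t * (t * 1))) by ring.
    rewrite (pow_n_pow (-1 * (t * (t * 1)))), (Rpow_mult_distr (-1)).
    transitivity (((-1) ^ length l * (-1) ^ length l) *
      ((-1) ^ n * (t * (t * 1)) ^ n * s)); [ring|].
    rewrite sqr_pow_minus_one. ring.
Qed.

(** * Convergence at 1 when the last entry is barred *)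

Lemma ex_series_telescope (b : nat -> R) :
  is_lim_seq b 0 -> ex_series (fun i => b i - b (S i)).
Proof.
  intros Hb. exists (b 0%nat - 0).
  assert (E : forall n, b 0%nat - b (S n) = sum_n (fun i => b i - b (S i)) n).
  { induction n as [|n IH].
    - now rewrite sum_n_zero.
    - rewrite sum_n_succ, <- IH. ring. }
  change (is_lim_seq (sum_n (fun i => b i - b (S i))) (b 0%nat - 0)).
  apply (is_lim_seq_ext _ _ _ E).
  apply is_lim_seq_minus'; [apply is_lim_seq_const|].
  now apply (is_lim_seq_incr_1 b).
Qed.

(* [(-1)^i b_i] is half of a telescoping term plus half of the absolutely
   summable [(-1)^i (b_i - b_{i+1})]. *)
Lemma ex_series_alternating (b : nat -> R) :
  is_lim_seq b 0 -> ex_series (fun i => Rabs (b i - b (S i))) ->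
  ex_series (fun i => (-1) ^ i * b i).
Proof.
  intros Hb Hs.
  assert (E1 : ex_series (fun i => (-1) ^ i * b i - (-1) ^ S i * b (S i))).
  { apply (ex_series_telescope (fun i => (-1) ^ i * b i)).
    apply is_lim_seq_abs_0.
    apply is_lim_seq_ext with (fun n => Rabs (b n)).
    - intros n. now rewrite Rabs_mult, pow_1_abs, Rmult_1_l.
    - now apply -> is_lim_seq_abs_0. }
  assert (E2 : ex_series (fun i => (-1) ^ i * (b i - b (S i)))).
  { apply ex_series_Rabs. eapply ex_series_ext; [|exact Hs].
    intros n. simpl. now rewrite Rabs_mult, pow_1_abs, Rmult_1_l. }
  pose proof (ex_series_scal (/ 2) _ (ex_series_plus _ _ E1 E2)) as E3.
  eapply ex_series_ext; [|exact E3].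
  intros n. unfold scal, plus; simpl; unfold mult; simpl. field.
Qed.

Lemma pow_diff_bound (x y : R) (k : nat) :
  0 <= y <= x -> x <= 1 -> 0 <= x ^ k - y ^ k <= INR k * (x - y).
Proof.
  intros Hy Hx. induction k as [|k IH].
  - simpl. lra.
  - rewrite S_INR. simpl.
    assert (0 <= y ^ k <= 1).
    { split; [now apply pow_le|]. rewrite <- (pow1 k). apply pow_incr. lra. }
    replace (x * x ^ k - y * y ^ k) with (x * (x ^ k - y ^ k) + (x - y) * y ^ k) by ring.
    pose proof (pos_INR k). split; [nra|].
    assert (x * (x ^ k - y ^ k) <= 1 * (INR k * (x - y))) by (apply Rmult_le_compat; lra).
    nra.
Qed.

(** [pow_diff_bound] at [1/d] and [1/(d+2)], whose difference is [2/(d (d+2))]. *)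
Lemma weight_diff_bound (m p k : nat) :
  let w := fun m => / (2 * INR m + INR (S p)) ^ k in
  0 <= w m - w (S m) <= 2 * INR k / INR (S m) ^ 2.
Proof.
  intros w. unfold w. rewrite <- !pow_inv.
  pose proof (denom_ge m p) as D. pose proof (denom_ge (S m) p) as D'.
  rewrite (S_INR (S m)) in D'.
  assert (H1 : 1 <= INR (S m)) by (rewrite S_INR; pose proof (pos_INR m); lra).
  assert (Hd : 2 * INR (S m) + INR (S p) = 2 * INR m + INR (S p) + 2)
    by (rewrite (S_INR m); ring).
  rewrite Hd in *. set (d := 2 * INR m + INR (S p)) in *. set (s := INR (S m)) in *.
  assert (Hle : 0 <= / (d + 2) <= / d).
  { split; [apply Rlt_le, Rinv_0_lt_compat; lra|apply Rinv_le_contravar; lra]. }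
  assert (Hd1 : / d <= 1) by (rewrite <- Rinv_1; apply Rinv_le_contravar; lra).
  destruct (pow_diff_bound (/ d) (/ (d + 2)) k Hle Hd1) as [P1 P2].
  split; [easy|].
  eapply Rle_trans; [exact P2|].
  replace (2 * INR k / s ^ 2) with (INR k * (2 * (/ s * / s))) by (field; lra).
  apply Rmult_le_compat_l; [apply pos_INR|].
  replace (/ d - / (d + 2)) with (2 * (/ d * / (d + 2))) by (field; lra).
  apply Rmult_le_compat_l; [lra|].
  apply Rmult_le_compat; try lra; try (apply Rlt_le, Rinv_0_lt_compat; lra);
    apply Rinv_le_contravar; lra.
Qed.

Lemma is_lim_seq_inv_sqrt : is_lim_seq (fun n => / sqrt (INR (S n))) 0.
Proof.
  replace (Finite 0) with (Rbar_inv p_infty) by reflexivity.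
  apply is_lim_seq_inv; [|easy].
  apply (is_lim_seq_incr_1 (fun n => sqrt (INR n))).
  eapply filterlim_comp; [apply is_lim_seq_INR|exact filterlim_sqrt_p].
Qed.

(** Bounds [(n+1)^(-3/2)] by a telescoping, hence summable, sequence. With [y^2 - x^2 = 1] the
    difference of inverses is [1/(x y (x+y))], and [y <= 2 x] gives the constant 6. *)
Lemma inv_sqrt_diff (n : nat) :
  / sqrt (INR (S n)) ^ 3 <= 6 * (/ sqrt (INR (S n)) - / sqrt (INR (S (S n)))).
Proof.
  pose proof (sqrt_S_pos n) as P1. pose proof (sqrt_S_pos (S n)) as P2.
  pose proof (sqrt_S_sqr n) as Q1. pose proof (sqrt_S_sqr (S n)) as Q2.
  rewrite (S_INR (S n)) in Q2 at 3.
  assert (H1 : 1 <= INR (S n)) by (rewrite S_INR; pose proof (pos_INR n); lra).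
  set (x := sqrt (INR (S n))) in *. set (y := sqrt (INR (S (S n)))) in *.
  assert (x <= y) by nra. assert (y <= 2 * x) by nra.
  apply Rmult_le_reg_r with (x ^ 3 * y * (x + y)).
  { repeat apply Rmult_lt_0_compat; try apply pow_lt; lra. }
  replace (/ x ^ 3 * (x ^ 3 * y * (x + y))) with (y * (x + y)) by (field; lra).
  replace (6 * (/ x - / y) * (x ^ 3 * y * (x + y)))
    with (6 * x * x * (y * y - x * x)) by (field; lra).
  replace (y * y - x * x) with 1 by lra. nra.
Qed.

(** The bar on the last entry supplies the alternating sign, even for [k = 1]. Without that sign the
    coefficients tend to 0 with differences of order [n^(-3/2)], so the criterion above applies. *)
Lemma ex_series_coef (k : nat) (l : list entry) :
  pos_entries ((k, true) :: l) -> ex_series (coef ((k, true) :: l)).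
Proof.
  intros Hl.
  set (b := coef ((k, false) :: l)).
  assert (Hb : pos_entries ((k, false) :: l)) by exact (pos_entries_flip _ Hl).
  assert (Hlim : is_lim_seq b 0).
  { destruct (coef_bound _ Hb) as [C [HC H]].
    apply is_lim_seq_abs_0.
    apply is_lim_seq_le_le with (fun _ => 0) (fun n => C * / sqrt (INR (S n))).
    - intros n. split; [apply Rabs_pos|apply H].
    - apply is_lim_seq_const.
    - replace (Finite 0) with (Rbar_mult C 0) by (simpl; now rewrite Rmult_0_r).
      apply is_lim_seq_scal_l, is_lim_seq_inv_sqrt. }
  assert (Hs : ex_series (fun i => Rabs (b i - b (S i)))).
  { apply Forall_cons_iff in Hl. destruct Hl as [Hk Hl]. cbn [fst] in Hk.
    destruct (coef_bound _ Hl) as [C [HC H]].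
    apply (ex_series_le (K := R_AbsRing) (V := R_CompleteNormedModule)) with
      (fun n => (4 * INR k + 1) * C * 6 *
                (/ sqrt (INR (S n)) - / sqrt (INR (S (S n))))).
    - intros n.
      change (Rabs (Rabs (b n - b (S n))) <= (4 * INR k + 1) * C * 6 *
                (/ sqrt (INR (S n)) - / sqrt (INR (S (S n))))).
      rewrite Rabs_Rabsolu.
      set (p := length l).
      set (w := fun m => / (2 * INR m + INR (S p)) ^ k).
      (* Discrete product rule for partial sum times weight. The two pieces are bounded by
         [4 k C / x^3] and [C / x^3], which explains the constant in the majorant. *)
      assert (E : b n - b (S n) =
        sum_n (coef l) n * (w n - w (S n)) - coef l (S n) * w (S n)).
      { unfold b. cbn [coef sgn]. rewrite sum_n_succ. unfold w, p, Rdiv. ring. }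
      rewrite E.
      pose proof (sum_n_sqrt_bound _ _ HC H n) as B1.
      pose proof (H (S n)) as B2.
      pose proof (weight_diff_bound n p k) as W1. cbv zeta in W1. fold w in W1.
      change (0 <= w n - w (S n) <= 2 * INR k / INR (S n) ^ 2) in W1.
      pose proof (inv_denom_pow (S n) p k Hk) as W2.
      change (0 < w (S n) <= / INR (S (S n))) in W2.
      pose proof (inv_sqrt_diff n) as I.
      pose proof (sqrt_S_pos n) as P1. pose proof (sqrt_S_pos (S n)) as P2.
      pose proof (sqrt_S_sqr n) as Q1. pose proof (sqrt_S_sqr (S n)) as Q2.
      assert (Hxy : sqrt (INR (S n)) <= sqrt (INR (S (S n)))).
      { apply sqrt_le_1; try apply pos_INR. apply le_INR. lia. }
      rewrite <- Q1 in W1. rewrite <- Q2 in W2.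
      set (x := sqrt (INR (S n))) in *. set (y := sqrt (INR (S (S n)))) in *.
      pose proof (pos_INR k) as Hk0.
      assert (C1 : Rabs (sum_n (coef l) n * (w n - w (S n))) <= 4 * INR k * C * / x ^ 3).
      { rewrite Rabs_mult, (Rabs_pos_eq (w n - w (S n))) by easy.
        replace (4 * INR k * C * / x ^ 3) with ((2 * C * x) * (2 * INR k / (x * x) ^ 2))
          by (field; lra).
        apply Rmult_le_compat; try easy. apply Rabs_pos. }
      assert (C2 : Rabs (coef l (S n) * w (S n)) <= C * / x ^ 3).
      { rewrite Rabs_mult, (Rabs_pos_eq (w (S n))) by lra.
        apply Rle_trans with (C / y * / (y * y)).
        - apply Rmult_le_compat; try easy; [apply Rabs_pos|lra].
        - replace (C / y * / (y * y)) with (C * / y ^ 3) by (field; lra).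
          apply Rmult_le_compat_l; [easy|].
          apply Rinv_le_contravar; [apply pow_lt; lra|].
          apply pow_incr. lra. }
      unfold Rminus at 1. eapply Rle_trans; [apply Rabs_triang|]. rewrite Rabs_Ropp.
      apply Rle_trans with ((4 * INR k + 1) * C * / x ^ 3); [lra|].
      rewrite Rmult_assoc with (r2 := 6).
      apply Rmult_le_compat_l; [apply Rmult_le_pos; lra|easy].
    - exact (ex_series_scal (V := R_NormedModule) _ _
        (ex_series_telescope _ is_lim_seq_inv_sqrt)). }
  pose proof (ex_series_scal ((-1) ^ S (length l)) _ (ex_series_alternating b Hlim Hs)) as E.
  assert (Hn : forall n, (-1) ^ S (length l) * ((-1) ^ n * b n) = coef ((k, true) :: l) n).
  { intros n. unfold b. cbn [coef sgn]. rewrite pow_add. unfold Rdiv. ring. }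
  exact (ex_series_ext _ _ Hn E).
Qed.

(** * Values at 1 and a calculus of limits *)

(** A radius above 1 puts 1 inside the disc, where the series is continuous; [Abel] handles radius
    exactly 1. *)
Lemma PSeries_at_left_1 (a : nat -> R) :
  Rbar_le 1 (CV_radius a) -> ex_series a ->
  filterlim (PSeries a) (at_left 1) (locally (Series a)).
Proof.
  intros Hr Ha. rewrite <- PSeries_1.
  apply ex_pseries_1 in Ha.
  destruct (Rbar_le_lt_or_eq_dec _ _ Hr) as [Hlt|Heq].
  - assert (Hc : continuity_pt (PSeries a) 1).
    { apply PSeries_continuity. now rewrite Rabs_R1. }
    apply continuity_pt_filterlim in Hc.
    eapply filterlim_filter_le_1; [|exact Hc].
    apply filter_le_within.
  - pose proof (Abel a) as A. rewrite <- Heq in A. simpl in A.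
    apply A; [lra|easy|easy].
Qed.

(** [Lim_seq] is total, so convergence is what makes [Tval] the genuine sum. Shifting the truncation
    by [S (length l)] leaves the limit unchanged. *)
Lemma Tval_series (l : list entry) :
  ex_series (coef l) -> Tval (rev l) = 2 ^ length l * Series (coef l).
Proof.
  intros H. unfold Tval. rewrite length_rev, rev_involutive. f_equal.
  rewrite (is_lim_seq_unique _ (Series (coef l))); [easy|].
  apply (is_lim_seq_incr_n _ (S (length l))).
  apply is_lim_seq_ext with (sum_n (coef l)).
  - intros n. now rewrite Gtrunc_coef.
  - exact (Series_correct _ H).
Qed.

Lemma flim_const {F : (R -> Prop) -> Prop} {FF : Filter F} (c : R) :
  filterlim (fun _ : R => c) F (locally c).
Proof. apply filterlim_const. Qed.

Lemma flim_plus {F : (R -> Prop) -> Prop} {FF : Filter F}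
    (f g : R -> R) (a b : R) :
  filterlim f F (locally a) -> filterlim g F (locally b) ->
  filterlim (fun t => f t + g t) F (locally (a + b)).
Proof. intros Hf Hg. exact (filterlim_comp_2 _ _ _ Hf Hg (filterlim_plus (V := R_NormedModule) a b)). Qed.

Lemma flim_mult {F : (R -> Prop) -> Prop} {FF : Filter F}
    (f g : R -> R) (a b : R) :
  filterlim f F (locally a) -> filterlim g F (locally b) ->
  filterlim (fun t => f t * g t) F (locally (a * b)).
Proof. intros Hf Hg. exact (filterlim_comp_2 _ _ _ Hf Hg (filterlim_mult (K := R_AbsRing) a b)). Qed.

Lemma flim_scal {F : (R -> Prop) -> Prop} {FF : Filter F}
    (f : R -> R) (c a : R) :
  filterlim f F (locally a) -> filterlim (fun t => c * f t) F (locally (c * a)).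
Proof. intros Hf. apply flim_mult; [apply flim_const|easy]. Qed.

Lemma flim_pow {F : (R -> Prop) -> Prop} {FF : Filter F}
    (f : R -> R) (a : R) (n : nat) :
  filterlim f F (locally a) -> filterlim (fun t => f t ^ n) F (locally (a ^ n)).
Proof.
  intros Hf. induction n as [|n IH]; simpl.
  - apply flim_const.
  - now apply flim_mult.
Qed.

Lemma flim_lsum {F : (R -> Prop) -> Prop} {FF : Filter F}
    (f : nat -> R -> R) (a : nat -> R) (s : list nat) :
  (forall i, In i s -> filterlim (f i) F (locally (a i))) ->
  filterlim (fun t => lsum (fun i => f i t) s) F (locally (lsum a s)).
Proof.
  induction s as [|i s IH]; intros H.
  - apply flim_const.
  - apply flim_plus.
    + apply H. now left.
    + apply IH. intros j Hj. apply H. now right.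
Qed.

Lemma at_left_1_pos : at_left 1 (fun t => 0 < t < 1).
Proof.
  exists (mkposreal 1 Rlt_0_1). intros t Ht Hlt.
  unfold ball in Ht; simpl in Ht; unfold AbsRing_ball, abs, minus, plus, opp in Ht; simpl in Ht.
  apply Rabs_def2 in Ht. lra.
Qed.

Lemma at_right_0_half : at_right 0 (fun t => 0 < t <= / 2).
Proof.
  assert (H : 0 < / 2) by lra.
  exists (mkposreal _ H). intros t Ht Hlt.
  unfold ball in Ht; simpl in Ht; unfold AbsRing_ball, abs, minus, plus, opp in Ht; simpl in Ht.
  apply Rabs_def2 in Ht. lra.
Qed.

Lemma at_left_id (x : R) : filterlim (fun t => t) (at_left x) (locally x).
Proof. intros P HP. now apply filter_le_within. Qed.

Lemma filterlim_sqr_at_left_1 : filterlim (fun t => t ^ 2) (at_left 1) (at_left 1).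
Proof.
  intros P HP.
  assert (H : filterlim (fun t => t ^ 2) (at_left 1) (locally 1)).
  { rewrite <- (pow1 2) at 2. apply flim_pow, at_left_id. }
  specialize (H _ HP). unfold filtermap in *.
  generalize (filter_and _ _ H at_left_1_pos). apply filter_imp.
  intros t [H1 H2]. apply H1. nra.
Qed.

Lemma Afun_at_left_1_series (l : list entry) :
  pos_entries l -> ex_series (coef l) ->
  filterlim (Afun l) (at_left 1) (locally (Tval (rev l))).
Proof.
  intros Hl E. rewrite (Tval_series l E). unfold Afun.
  apply flim_scal.
  replace (Series (coef l)) with (1 ^ length l * Series (coef l)) by (rewrite pow1; ring).
  apply flim_mult.
  - apply flim_pow, at_left_id.
  - eapply filterlim_comp; [apply filterlim_sqr_at_left_1|].
    apply PSeries_at_left_1; [now apply coef_radius|easy].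
Qed.

Lemma Afun_at_left_1 (k : nat) (l : list entry) :
  pos_entries ((k, true) :: l) ->
  filterlim (Afun ((k, true) :: l)) (at_left 1) (locally (Tval (rev ((k, true) :: l)))).
Proof. intros Hl. exact (Afun_at_left_1_series _ Hl (ex_series_coef k l Hl)). Qed.

(** * Behaviour at 0 *)

(** A bound of order [t] at 0, strong enough to beat every power of [ln t]. The range stops at 1/2
    to stay away from the singularity at 1. *)
Definition vanishing (f : R -> R) : Prop :=
  exists C, forall t, 0 < t <= / 2 -> Rabs (f t) <= C * t.

(** A nonempty list leaves at least one factor [t], and the series is dominated by
    [M / (1 - t^2) <= 2 M]. *)
Lemma Afun_vanishing (l : list entry) : pos_entries l -> l <> [] -> vanishing (Afun l).
Proof.
  intros Hl Hn. destruct (coef_bounded l Hl) as [M HM].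
  assert (HM0 : 0 <= M) by (eapply Rle_trans; [apply Rabs_pos|apply (HM 0%nat)]).
  exists (2 ^ length l * (M * 2)). intros t Ht.
  assert (Hu : 0 <= t ^ 2 <= / 2) by nra.
  assert (Hua : Rabs (t ^ 2) < 1) by (rewrite Rabs_pos_eq; lra).
  assert (HP : Rabs (PSeries (coef l) (t ^ 2)) <= M * 2).
  { unfold PSeries. eapply Rle_trans.
    - apply Series_Rabs, CV_disk_inside, radius_lt; [now apply coef_radius|easy].
    - apply Rle_trans with (Series (fun n => M * (t ^ 2) ^ n)).
      + apply Series_le.
        * intros n. split; [apply Rabs_pos|].
          rewrite Rabs_mult, (Rabs_pos_eq ((t ^ 2) ^ n)) by now apply pow_le.
          apply Rmult_le_compat_r; [now apply pow_le|easy].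
        * exact (ex_series_scal (V := R_NormedModule) M _ (ex_series_geom _ Hua)).
      + rewrite Series_scal_l, Series_geom by easy.
        apply Rmult_le_compat_l; [easy|].
        apply Rle_trans with (/ / 2); [apply Rinv_le_contravar; lra|].
        rewrite Rinv_inv. lra. }
  unfold Afun. destruct l as [|e l]; [easy|]. set (L := e :: l) in *.
  rewrite !Rabs_mult, (Rabs_pos_eq (2 ^ _)), (Rabs_pos_eq (t ^ _)) by (apply pow_le; lra).
  rewrite Rmult_assoc. apply Rmult_le_compat_l; [apply pow_le; lra|].
  rewrite (Rmult_comm (M * 2) t).
  apply Rmult_le_compat; [apply pow_le; lra|apply Rabs_pos| |easy].
  unfold L. simpl. rewrite <- (Rmult_1_r t) at 3.
  apply Rmult_le_compat_l; [lra|]. rewrite <- (pow1 (length l)). apply pow_incr. lra.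
Qed.

(** * Derivatives and constancy on ]0, 1[ *)

Lemma is_derive_Rplus (f g : R -> R) (t a b : R) :
  is_derive f t a -> is_derive g t b -> is_derive (fun t => f t + g t) t (a + b).
Proof. intros Hf Hg. exact (is_derive_plus f g t a b Hf Hg). Qed.

Lemma is_derive_Rmult (f g : R -> R) (t a b : R) :
  is_derive f t a -> is_derive g t b ->
  is_derive (fun t => f t * g t) t (a * g t + f t * b).
Proof. intros Hf Hg. exact (is_derive_mult f g t a b Hf Hg Rmult_comm). Qed.

Lemma is_derive_eq (f : R -> R) (t a b : R) : is_derive f t a -> a = b -> is_derive f t b.
Proof. now intros H <-. Qed.

Lemma zero_derive_const (f : R -> R) :
  (forall t, 0 < t < 1 -> is_derive f t 0) ->
  forall s t, 0 < s < 1 -> 0 < t < 1 -> f s = f t.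
Proof.
  intros H s t Hs Ht.
  assert (Hin : forall x, Rmin s t <= x <= Rmax s t -> 0 < x < 1).
  { intros x Hx. unfold Rmin, Rmax in Hx. destruct (Rle_dec s t); lra. }
  destruct (MVT_gen f s t (fun _ => 0)) as [c [_ E]].
  - intros x Hx. apply H, Hin. lra.
  - intros x Hx. apply derivable_continuous_pt.
    exists 0. apply is_derive_Reals, H, Hin, Hx.
  - lra.
Qed.

Lemma at_right_0_lt_1 : at_right 0 (fun t => 0 < t < 1).
Proof. eapply filter_imp; [|apply at_right_0_half]. intros t Ht. simpl in Ht. lra. Qed.

Lemma zero_derive_limit (F : (R -> Prop) -> Prop) {FF : ProperFilter F} (f : R -> R) (a : R) :
  (forall t, 0 < t < 1 -> is_derive f t 0) ->
  F (fun t => 0 < t < 1) -> filterlim f F (locally a) ->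
  forall t, 0 < t < 1 -> f t = a.
Proof.
  intros H HF Ha t Ht.
  apply (filterlim_locally_unique (K := R_AbsRing) (V := R_NormedModule) (F := F) f);
    [|exact Ha].
  apply filterlim_ext_loc with (fun _ => f t); [|apply filterlim_const].
  eapply filter_imp; [|exact HF]. intros s Hs. now apply zero_derive_const.
Qed.

(** Stands in for integration from 0 to 1: the boundary values of a constant function agree. *)
Lemma zero_derive_limits_eq (f : R -> R) (a b : R) :
  (forall t, 0 < t < 1 -> is_derive f t 0) ->
  filterlim f (at_right 0) (locally a) -> filterlim f (at_left 1) (locally b) -> a = b.
Proof.
  intros H Ha Hb.
  assert (Hh : 0 < / 2 < 1) by lra.
  rewrite <- (zero_derive_limit _ f a H at_right_0_lt_1 Ha (/ 2) Hh).
  now rewrite <- (zero_derive_limit _ f b H at_left_1_pos Hb (/ 2) Hh).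
Qed.

(** * Divided powers of the logarithm *)

Definition ell (j : nat) (t : R) : R := (- ln t) ^ j / INR (fact j).

Lemma ell_0 (t : R) : ell 0 t = 1.
Proof. unfold ell. simpl. field. Qed.

Lemma is_derive_ell_S (j : nat) (t : R) : 0 < t -> is_derive (ell (S j)) t (- ell j t / t).
Proof.
  intros Ht. unfold ell.
  assert (D : is_derive (fun t => - ln t) t (- / t)).
  { auto_derive; [easy|]. field. lra. }
  assert (P : is_derive (fun y => y ^ S j) (- ln t) (INR (S j) * (- ln t) ^ j)).
  { apply is_derive_Reals, (derivable_pt_lim_pow _ (S j)). }
  assert (DP : is_derive (fun t => (- ln t) ^ S j) t (- / t * (INR (S j) * (- ln t) ^ j)))
    by exact (is_derive_comp _ _ _ _ _ P D).
  eapply is_derive_eq.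
  - apply is_derive_ext with (fun t => / INR (fact (S j)) * (- ln t) ^ S j).
    + intros s. unfold Rdiv. apply Rmult_comm.
    + apply is_derive_scal. exact DP.
  - rewrite fact_simpl, mult_INR. field.
    pose proof (INR_fact_neq_0 j). pose proof (not_0_INR (S j) ltac:(lia)). repeat split; try easy; lra.
Qed.

Lemma is_derive_ell_0 (t : R) : is_derive (ell 0) t 0.
Proof.
  apply is_derive_ext with (fun _ => 1); [intros s; now rewrite ell_0|].
  apply (is_derive_const (V := R_NormedModule) 1).
Qed.

Lemma filterlim_ln_at_left_1 : filterlim (fun t => - ln t) (at_left 1) (locally 0).
Proof.
  replace 0 with (-1 * ln 1) by (rewrite ln_1; ring).
  apply filterlim_ext with (fun t => -1 * ln t); [intros; ring|].
  apply flim_scal. eapply filterlim_filter_le_1; [apply filter_le_within|].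
  apply continuity_pt_filterlim, derivable_continuous_pt.
  exists (/ 1). apply derivable_pt_lim_ln. lra.
Qed.

Lemma ell_S_at_left_1 (j : nat) : filterlim (ell (S j)) (at_left 1) (locally 0).
Proof.
  unfold ell, Rdiv. replace 0 with (0 ^ S j * / INR (fact (S j))) by (simpl; ring).
  apply flim_mult; [|apply flim_const].
  apply flim_pow, filterlim_ln_at_left_1.
Qed.

Lemma ell_0_lim {F : (R -> Prop) -> Prop} {FF : Filter F} : filterlim (ell 0) F (locally 1).
Proof.
  apply filterlim_ext with (fun _ => 1); [intros; now rewrite ell_0|].
  apply flim_const.
Qed.

(** With [y = - ln t], keeping only the top Taylor term gives [exp y >= y^(j+1)/(j+1)!], and
    [t = exp (- y)]. The bound tends to 0 with [t]. *)
Lemma ell_mult_bound (j : nat) (t : R) :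
  0 < t < 1 -> 0 <= t * ell j t <= INR (S j) * / (- ln t).
Proof.
  intros Ht.
  assert (Hy : 0 < - ln t).
  { rewrite <- ln_1, <- ln_Rinv by lra. rewrite ln_1.
    rewrite <- ln_1. apply ln_increasing; [lra|].
    rewrite <- Rinv_1. apply Rinv_lt_contravar; lra. }
  set (y := - ln t) in *.
  assert (Et : t = / exp y) by (unfold y; rewrite <- exp_Ropp, Ropp_involutive, exp_ln; lra).
  pose proof (exp_pos y) as He.
  pose proof (INR_fact_lt_0 j) as F1.
  pose proof (lt_0_INR (S j) ltac:(lia)) as F2.
  assert (Hexp : y ^ S j / INR (fact (S j)) <= exp y).
  { eapply Rle_trans; [|apply (exp_ge_taylor y (S j)); lra].
    rewrite tech5. rewrite <- Rplus_0_l at 1. apply Rplus_le_compat_r.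
    apply cond_pos_sum. intros n. apply Rlt_le, Rdiv_lt_0_compat;
      [now apply pow_lt|apply INR_fact_lt_0]. }
  unfold ell. fold y. split.
  - apply Rmult_le_pos; [lra|]. apply Rlt_le, Rdiv_lt_0_compat; [now apply pow_lt|easy].
  - rewrite Et.
    apply Rmult_le_reg_r with (exp y * y / INR (S j)).
    { apply Rdiv_lt_0_compat; [apply Rmult_lt_0_compat|]; easy. }
    replace (INR (S j) * / y * (exp y * y / INR (S j))) with (exp y) by (field; lra).
    eapply Rle_trans; [|exact Hexp]. right.
    rewrite fact_simpl, mult_INR. simpl pow. field. lra.
Qed.

Lemma vanishing_mult_ell (f : R -> R) (j : nat) :
  vanishing f -> filterlim (fun t => f t * ell j t) (at_right 0) (locally 0).
Proof.
  intros [C HC].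
  assert (HL : filterlim (fun t => Rmax 0 C * (INR (S j) * / (- ln t))) (at_right 0)
    (locally (Rmax 0 C * (INR (S j) * 0)))).
  { apply flim_scal, flim_scal.
    apply (filterlim_comp _ _ _ (fun t => - ln t) Rinv _ (Rbar_locally p_infty)).
    - apply (filterlim_comp _ _ _ ln Ropp _ (Rbar_locally m_infty)); [exact is_lim_ln_0|].
      apply (filterlim_Rbar_opp m_infty).
    - apply (filterlim_Rbar_inv p_infty). easy. }
  rewrite !Rmult_0_r in HL.
  apply (filterlim_locally (F := at_right 0) (U := R_UniformSpace)). intros eps.
  apply (proj1 (filterlim_locally (F := at_right 0) (U := R_UniformSpace) _ _)) with (eps := eps) in HL.
  generalize (filter_and _ _ HL at_right_0_half). apply filter_imp.
  intros t [H1 H2].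
  unfold ball in *; simpl in *; unfold AbsRing_ball, abs, minus, plus, opp in *; simpl in *.
  eapply Rle_lt_trans; [|exact H1].
  rewrite !Ropp_0, !Rplus_0_r.
  destruct (ell_mult_bound j t) as [B1 B2]; [lra|].
  eapply Rle_trans; [|apply Rle_abs].
  rewrite Rabs_mult.
  assert (He : 0 <= ell j t).
  { apply Rmult_le_reg_l with t; lra. }
  rewrite (Rabs_pos_eq _ He).
  apply Rle_trans with (Rmax 0 C * t * ell j t).
  - apply Rmult_le_compat_r; [easy|]. eapply Rle_trans; [now apply HC|].
    apply Rmult_le_compat_r; [lra|apply Rmax_r].
  - rewrite Rmult_assoc. apply Rmult_le_compat_l; [apply Rmax_l|easy].
Qed.

Lemma vanishing_lim (f : R -> R) :
  vanishing f -> filterlim f (at_right 0) (locally 0).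
Proof.
  intros H. apply filterlim_ext with (fun t => f t * ell 0 t).
  - intros t. rewrite ell_0. ring.
  - now apply vanishing_mult_ell.
Qed.

Lemma vanishing_zero : vanishing (fun _ => 0).
Proof. exists 0. intros t Ht. rewrite Rabs_R0. lra. Qed.

Lemma vanishing_plus (f g : R -> R) :
  vanishing f -> vanishing g -> vanishing (fun t => f t + g t).
Proof.
  intros [C HC] [D HD]. exists (C + D). intros t Ht.
  eapply Rle_trans; [apply Rabs_triang|].
  specialize (HC t Ht). specialize (HD t Ht). lra.
Qed.

Lemma vanishing_scal (f : R -> R) (c : R) : vanishing f -> vanishing (fun t => c * f t).
Proof.
  intros [C HC]. exists (Rabs c * C). intros t Ht.
  rewrite Rabs_mult, Rmult_assoc. apply Rmult_le_compat_l; [apply Rabs_pos|now apply HC].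
Qed.

(** * Convolutions with the divided powers *)

(** The sum of [f_i ell_(n-i)] over [0 <= i <= n]. The recursion shifts [f], so that inductions
    apply to the tail of the family. *)
Fixpoint conv (f : nat -> R -> R) (n : nat) (t : R) : R :=
  match n with
  | O => f O t * ell 0 t
  | S n' => f O t * ell n t + conv (fun i => f (S i)) n' t
  end.

(* The contributions [f_i ell_(n-i-1) / t] of consecutive terms cancel. *)
Lemma is_derive_conv (n : nat) (f : nat -> R -> R) (h : nat -> R) (z t : R) :
  0 < t -> is_derive (f O) t (h O + z / t) ->
  (forall i, is_derive (f (S i)) t (h (S i) + f i t / t)) ->
  is_derive (conv f n) t (conv (fun i _ => h i) n t + z * ell n t / t).
Proof.
  intros Ht. revert f h z. induction n as [|n IH]; intros f h z H0 HS; cbn [conv].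
  - eapply is_derive_eq.
    + apply is_derive_Rmult; [exact H0|apply is_derive_ell_0].
    + rewrite ell_0. field. lra.
  - eapply is_derive_eq.
    + apply is_derive_Rplus.
      * apply is_derive_Rmult; [exact H0|now apply is_derive_ell_S].
      (* For the shifted family, [f O] is the entry before the first one and takes the role of
         [z]. *)
      * apply (IH (fun i => f (S i)) (fun i => h (S i)) (f O t)); [apply HS|].
        intros i. apply HS.
    + field. lra.
Qed.

Lemma conv_at_right_0 (n : nat) (f : nat -> R -> R) :
  (forall i, vanishing (f i)) -> filterlim (conv f n) (at_right 0) (locally 0).
Proof.
  revert f. induction n as [|n IH]; intros f H; cbn [conv].
  - now apply vanishing_mult_ell.
  - rewrite <- (Rplus_0_l 0) at 2. apply flim_plus; [now apply vanishing_mult_ell|].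
    apply IH. intros i. apply H.
Qed.

(** Positive powers of [ln t] vanish at 1, so only the term with [ell 0] survives. *)
Lemma conv_at_left_1 (n : nat) (f : nat -> R -> R) (a : nat -> R) :
  (forall i, filterlim (f i) (at_left 1) (locally (a i))) ->
  filterlim (conv f n) (at_left 1) (locally (a n)).
Proof.
  revert f a. induction n as [|n IH]; intros f a H; cbn [conv].
  - rewrite <- (Rmult_1_r (a O)). apply flim_mult; [easy|apply ell_0_lim].
  - rewrite <- (Rplus_0_l (a (S n))), <- (Rmult_0_r (a O)).
    apply flim_plus.
    + apply flim_mult; [easy|apply ell_S_at_left_1].
    + apply (IH (fun i => f (S i)) (fun i => a (S i))). intros i. apply H.
Qed.

Lemma conv_scal (n : nat) (f : nat -> R -> R) (c t : R) :
  conv (fun i _ => c * f i t) n t = c * conv f n t.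
Proof.
  revert f. induction n as [|n IH]; intros f; cbn [conv].
  - ring.
  - rewrite (IH (fun i => f (S i))). ring.
Qed.

Lemma conv_head (n : nat) (f : nat -> R -> R) (t : R) :
  (forall i, f (S i) t = 0) -> conv f n t = f O t * ell n t.
Proof.
  revert f. induction n as [|n IH]; intros f H; cbn [conv]; [easy|].
  rewrite IH by (intros; apply H). rewrite H. ring.
Qed.

(** The index is [c = n - i + 1], which will be the last part of the compositions in [W]. *)
Lemma conv_lsum (n : nat) (f : nat -> R -> R) (t : R) :
  conv f n t = lsum (fun c => f (S n - c)%nat t * ell (c - 1) t) (seq 1 (S n)).
Proof.
  revert f. induction n as [|n IH]; intros f; cbn [conv].
  - unfold lsum. simpl. ring.
  - rewrite (seq_S (S n) 1), lsum_app, IH.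
    rewrite Rplus_comm. f_equal.
    + apply lsum_ext. intros c Hc. apply in_seq in Hc.
      now replace (S (S n) - c)%nat with (S (S n - c)) by lia.
    + unfold lsum. cbn [fold_right].
      replace (S (S n) - (1 + S n))%nat with O by lia.
      replace (1 + S n - 1)%nat with (S n) by lia. ring.
Qed.

(** * Finite sums and sums over compositions *)

Lemma lsum_cons (f : nat -> R) (x : nat) (l : list nat) : lsum f (x :: l) = f x + lsum f l.
Proof. reflexivity. Qed.

Lemma lsum_plus (f g : nat -> R) (l : list nat) :
  lsum (fun x => f x + g x) l = lsum f l + lsum g l.
Proof. induction l as [|x l IH]; rewrite ?lsum_cons, ?IH; [unfold lsum; simpl|]; ring. Qed.

Lemma lsum_scal (c : R) (f : nat -> R) (l : list nat) :
  lsum (fun x => c * f x) l = c * lsum f l.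
Proof. induction l as [|x l IH]; rewrite ?lsum_cons, ?IH; [unfold lsum; simpl|]; ring. Qed.

Lemma lsum_map (f : nat -> R) (g : nat -> nat) (l : list nat) :
  lsum f (map g l) = lsum (fun x => f (g x)) l.
Proof. induction l as [|x l IH]; [easy|]. cbn [map]. now rewrite !lsum_cons, IH. Qed.

Lemma lsum_comm (g : nat -> nat -> R) (l1 l2 : list nat) :
  lsum (fun a => lsum (g a) l2) l1 = lsum (fun c => lsum (fun a => g a c) l1) l2.
Proof.
  induction l1 as [|x l1 IH].
  - symmetry. now apply lsum_zero.
  - rewrite lsum_cons, IH, <- lsum_plus. reflexivity.
Qed.

Lemma lsum_restrict (f : nat -> R) (n k : nat) :
  (n <= k)%nat ->
  lsum f (seq 1 n) = lsum (fun c => if (c <=? n)%nat then f c else 0) (seq 1 k).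
Proof.
  intros H. replace k with (n + (k - n))%nat by lia.
  rewrite seq_app, lsum_app, (lsum_zero _ (seq (1 + n) _)), Rplus_0_r.
  - apply lsum_ext. intros x Hx. apply in_seq in Hx.
    now rewrite (proj2 (Nat.leb_le x n)) by lia.
  - intros x Hx. apply in_seq in Hx.
    now rewrite (proj2 (Nat.leb_gt x n)) by lia.
Qed.

(** Both sides run over the pairs [a, c >= 1] with [a + c <= k]. *)
Lemma lsum_triangle (g : nat -> nat -> R) (k : nat) :
  lsum (fun a => lsum (fun c => g a c) (seq 1 (k - a))) (seq 1 k) =
  lsum (fun c => lsum (fun a => g a c) (seq 1 (k - c))) (seq 1 k).
Proof.
  transitivity (lsum (fun a =>
    lsum (fun c => if (a + c <=? k)%nat then g a c else 0) (seq 1 k)) (seq 1 k)).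
  - apply lsum_ext. intros a Ha. apply in_seq in Ha.
    rewrite (lsum_restrict _ (k - a) k) by lia.
    apply lsum_ext. intros c Hc.
    destruct (Nat.leb_spec c (k - a)), (Nat.leb_spec (a + c) k); easy || lia.
  - rewrite lsum_comm. apply lsum_ext. intros c Hc. apply in_seq in Hc.
    rewrite (lsum_restrict _ (k - c) k) by lia.
    apply lsum_ext. intros a Ha.
    destruct (Nat.leb_spec a (k - c)), (Nat.leb_spec (a + c) k); easy || lia.
Qed.

Lemma lsum_telescope (g : nat -> R) (n : nat) :
  lsum (fun i => g i - g (i - 1)%nat) (seq 1 n) = g n - g O.
Proof.
  induction n as [|n IH].
  - unfold lsum. simpl. ring.
  - rewrite seq_S, lsum_app, IH, lsum_cons. unfold lsum. simpl. rewrite Nat.sub_0_r. ring.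
Qed.

(** The sum over [comps k r] as nested [lsum]s, a form through which derivatives and limits pass
    directly. *)
Fixpoint sumc (F : list nat -> R) (k r : nat) : R :=
  match r with
  | O => if Nat.eqb k 0 then F [] else 0
  | S r' => lsum (fun a => sumc (fun l => F (a :: l)) (k - a) r') (seq 1 k)
  end.

Definition lfold (F : list nat -> R) (L : list (list nat)) : R :=
  fold_right (fun ks acc => F ks + acc) 0 L.

Lemma lfold_app (F : list nat -> R) (L1 L2 : list (list nat)) :
  lfold F (L1 ++ L2) = lfold F L1 + lfold F L2.
Proof. unfold lfold. induction L1 as [|x L IH]; simpl; [|rewrite IH]; ring. Qed.

Lemma lfold_comps (F : list nat -> R) (k r : nat) : lfold F (comps k r) = sumc F k r.
Proof.
  revert F k. induction r as [|r IH]; intros F k.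
  - cbn [comps sumc]. destruct (Nat.eqb k 0); unfold lfold; simpl; ring.
  - cbn [comps sumc]. generalize (seq 1 k). intros s. induction s as [|a s IHs].
    + reflexivity.
    + cbn [flat_map]. rewrite lfold_app, IHs, lsum_cons. f_equal.
      rewrite <- IH. generalize (comps (k - a) r). intros L.
      unfold lfold. induction L as [|x L IHL]; simpl; [easy|]. now rewrite IHL.
Qed.

(** [P f a] stands for any additive relation, such as [f] having derivative or limit [a]. One
    induction then serves all of them, here and in [sumc_ind2]. *)
Lemma lsum_ind2 (P : (R -> R) -> R -> Prop) (F : nat -> R -> R) (d : nat -> R) (s : list nat) :
  P (fun _ => 0) 0 ->
  (forall f g a b, P f a -> P g b -> P (fun t => f t + g t) (a + b)) ->
  (forall i, In i s -> P (F i) (d i)) ->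
  P (fun t => lsum (fun i => F i t) s) (lsum d s).
Proof.
  intros H0 Hp. induction s as [|i s IH]; intros H; [exact H0|].
  apply Hp; [apply H; now left|]. apply IH. intros j Hj. apply H. now right.
Qed.

Lemma sumc_ind2 (P : (R -> R) -> R -> Prop) (F : list nat -> R -> R) (d : list nat -> R)
    (k r : nat) :
  P (fun _ => 0) 0 ->
  (forall f g a b, P f a -> P g b -> P (fun t => f t + g t) (a + b)) ->
  (forall l, List.Forall (fun i => (1 <= i)%nat) l -> P (F l) (d l)) ->
  P (fun t => sumc (fun l => F l t) k r) (sumc d k r).
Proof.
  intros H0 Hp. revert F d k. induction r as [|r IH]; intros F d k H; cbn [sumc].
  - destruct (Nat.eqb k 0); [apply H, Forall_nil|exact H0].
  - apply (lsum_ind2 P (fun a t => sumc (fun l => F (a :: l) t) (k - a) r)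
      (fun a => sumc (fun l => d (a :: l)) (k - a) r)); try easy.
    intros a Ha. apply in_seq in Ha.
    apply (IH (fun l => F (a :: l)) (fun l => d (a :: l))).
    intros l Hl. apply H. constructor; [lia|easy].
Qed.

Lemma sumc_ext (F G : list nat -> R) (k r : nat) :
  (forall l, length l = r -> F l = G l) -> sumc F k r = sumc G k r.
Proof.
  revert F G k. induction r as [|r IH]; intros F G k H; cbn [sumc].
  - now rewrite H.
  - apply lsum_ext. intros a _. apply IH. intros l Hl. apply H. simpl. now rewrite Hl.
Qed.

Lemma sumc_scal (c : R) (F : list nat -> R) (k r : nat) :
  sumc (fun l => c * F l) k r = c * sumc F k r.
Proof.
  revert F k. induction r as [|r IH]; intros F k; cbn [sumc].
  - destruct (Nat.eqb k 0); ring.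
  - rewrite <- lsum_scal. apply lsum_ext. intros a _. apply (IH (fun l => F (a :: l))).
Qed.

(** [W] singles out the last part while [sumc] recurses on the first; [lsum_triangle] exchanges the
    two. *)
Lemma sumc_snoc (F : list nat -> R) (k r : nat) :
  sumc F k (S r) = lsum (fun c => sumc (fun l => F (l ++ [c])) (k - c) r) (seq 1 k).
Proof.
  revert F k. induction r as [|r IH]; intros F k; [reflexivity|].
  transitivity (lsum (fun a => lsum (fun c =>
    sumc (fun l => F (a :: l ++ [c])) (k - a - c) r) (seq 1 (k - a))) (seq 1 k)).
  - cbn [sumc]. apply lsum_ext. intros a _. apply (IH (fun l => F (a :: l))).
  - rewrite lsum_triangle. cbn [sumc]. apply lsum_ext. intros c _. apply lsum_ext.
    intros a _. now replace (k - a - c)%nat with (k - c - a)%nat by lia.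
Qed.

Lemma sumc_rev (F : list nat -> R) (k r : nat) : sumc (fun l => F (rev l)) k r = sumc F k r.
Proof.
  revert F k. induction r as [|r IH]; intros F k; [reflexivity|].
  rewrite sumc_snoc. cbn [sumc]. apply lsum_ext. intros a _.
  rewrite <- (IH (fun l => F (a :: l))). apply sumc_ext. intros l _. now rewrite rev_app_distr.
Qed.

(** * The sums [W] split by their last part *)

Definition unbarred (l : list nat) : list entry := map (fun k => (k, false)) l.

Definition barhead (l : list nat) : list entry :=
  match l with
  | [] => []
  | k :: l' => (k, true) :: unbarred l'
  end.

Lemma flip_unbarred (l : list nat) : flip (unbarred l) = barhead l.
Proof. now destruct l. Qed.

Lemma pos_unbarred (l : list nat) :
  List.Forall (fun i => (1 <= i)%nat) l -> pos_entries (unbarred l).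
Proof.
  intros H. unfold unbarred. induction H; simpl; constructor; easy.
Qed.

Lemma Tbar_snoc (l : list nat) (x : nat) :
  Tbar (l ++ [x]) = Tval (rev ((x, true) :: unbarred (rev l))).
Proof.
  unfold Tbar. destruct (l ++ [x]) eqn:E; [now destruct l|]. rewrite <- E.
  rewrite removelast_last, last_last. cbn [rev]. unfold unbarred.
  now rewrite <- map_rev, rev_involutive.
Qed.

(** The part [c] is split off and its exponent raised to [c + m - 1]. The remaining parts may be
    reversed, since reversal permutes compositions. *)
Lemma W_sumc (m k p : nat) :
  W m k (S p) = lsum (fun c => Binomial.C (c + m - 2) (m - 1) *
    sumc (fun l => Tval (rev ((c + m - 1, true)%nat :: unbarred l))) (k - c) p) (seq 1 k).
Proof.
  unfold W.
  change (lfold (fun ks => Binomial.C (last ks 0%nat + m - 2) (m - 1) *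
    Tbar (removelast ks ++ [(last ks 0%nat + m - 1)%nat])) (comps k (S p)) = lsum (fun c =>
    Binomial.C (c + m - 2) (m - 1) *
    sumc (fun l => Tval (rev ((c + m - 1, true)%nat :: unbarred l))) (k - c) p) (seq 1 k)).
  rewrite lfold_comps, sumc_snoc. apply lsum_ext. intros c _.
  rewrite <- sumc_scal, <- sumc_rev. apply sumc_ext. intros l _.
  now rewrite removelast_last, last_last, Tbar_snoc, rev_involutive.
Qed.

(** * Sums of iterated integrals *)

Definition rho (t : R) : R := 2 / (1 + t ^ 2).

(* The factor [(-1) ^ length l] makes this the sum of the iterated integrals of all
   words that start with [rho dt] and have [p] letters [rho dt] and [q - p] letters [dt / t]. *)
Definition Sfun (p q : nat) (t : R) : R :=
  sumc (fun l => (-1) ^ length l * Afun (barhead l) t) q p.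

(** The words whose last letter [rho dt] is followed by exactly [a - 1] letters [dt / t], preceded
    by the words of [Sfun p n]. *)
Definition Hfun (a n p : nat) (t : R) : R :=
  sumc (fun l => (-1) ^ S (length l) * Afun ((a, true) :: unbarred l) t) n p.

Definition Hlim (a n p : nat) : R :=
  sumc (fun l => (-1) ^ S (length l) * Tval (rev ((a, true) :: unbarred l))) n p.

Lemma Sfun_S (p q : nat) (t : R) :
  Sfun (S p) q t = lsum (fun a => Hfun a (q - a) p t) (seq 1 q).
Proof. reflexivity. Qed.

Lemma is_derive_0 (t : R) : is_derive (fun _ : R => 0) t 0.
Proof. exact (is_derive_const (V := R_NormedModule) 0 t). Qed.

Lemma is_derive_Hfun_1 (n p : nat) (t : R) :
  0 < t < 1 -> is_derive (Hfun 1 n p) t (rho t * Sfun p n t).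
Proof.
  intros Ht. unfold Sfun. rewrite <- sumc_scal.
  apply (sumc_ind2 (fun f v => is_derive f t v)
    (fun l t => (-1) ^ S (length l) * Afun ((1%nat, true) :: unbarred l) t)).
  - apply is_derive_0.
  - intros f g a b. apply is_derive_Rplus.
  - intros l Hl. eapply is_derive_eq.
    + apply is_derive_scal, is_derive_Afun_1_true; [now apply pos_unbarred|easy].
    (* [flip] bars the new last entry, which makes the tail a term of [Sfun]; the minus sign from
       the derivative is absorbed by the power of -1. *)
    + rewrite flip_unbarred. unfold rho. simpl. field. nra.
Qed.

Lemma is_derive_Hfun_SS (a n p : nat) (t : R) :
  0 < t < 1 -> is_derive (Hfun (S (S a)) n p) t (Hfun (S a) n p t / t).
Proof.
  intros Ht. unfold Hfun at 2. unfold Rdiv. rewrite Rmult_comm, <- sumc_scal.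
  apply (sumc_ind2 (fun f v => is_derive f t v)
    (fun l t => (-1) ^ S (length l) * Afun ((S (S a), true) :: unbarred l) t)).
  - apply is_derive_0.
  - intros f g u v. apply is_derive_Rplus.
  - intros l Hl. eapply is_derive_eq.
    + apply is_derive_scal, is_derive_Afun_SS; [now apply pos_unbarred|easy].
    + unfold Rdiv. ring.
Qed.

Lemma pos_cons (a : nat) (b : bool) (l : list entry) :
  (1 <= a)%nat -> pos_entries l -> pos_entries ((a, b) :: l).
Proof. intros Ha Hl. now constructor. Qed.

Lemma Hfun_vanishing (a n p : nat) : (1 <= a)%nat -> vanishing (Hfun a n p).
Proof.
  intros Ha.
  apply (sumc_ind2 (fun f _ => vanishing f)
    (fun l t => (-1) ^ S (length l) * Afun ((a, true) :: unbarred l) t) (fun _ => 0)).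
  - apply vanishing_zero.
  - intros f g _ _. apply vanishing_plus.
  - intros l Hl. apply vanishing_scal, Afun_vanishing; [|easy].
    apply pos_cons; [easy|now apply pos_unbarred].
Qed.

Lemma Hfun_at_left_1 (a n p : nat) :
  (1 <= a)%nat -> filterlim (Hfun a n p) (at_left 1) (locally (Hlim a n p)).
Proof.
  intros Ha.
  apply (sumc_ind2 (fun f v => filterlim f (at_left 1) (locally v))
    (fun l t => (-1) ^ S (length l) * Afun ((a, true) :: unbarred l) t)
    (fun l => (-1) ^ S (length l) * Tval (rev ((a, true) :: unbarred l)))).
  - apply flim_const.
  - intros f g u v. apply flim_plus.
  - intros l Hl. apply flim_scal, Afun_at_left_1.
    apply pos_cons; [easy|now apply pos_unbarred].
Qed.

(** The words are split by their last letter: it is [rho dt] for [a = 1] and [dt / t] for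
    [a >= 2]. *)
Lemma is_derive_Sfun_S (p q : nat) (t : R) :
  0 < t < 1 ->
  is_derive (Sfun (S p) (S q)) t (rho t * Sfun p q t + Sfun (S p) q t / t).
Proof.
  intros Ht. eapply is_derive_eq.
  - apply (lsum_ind2 (fun f v => is_derive f t v) (fun a t => Hfun a (S q - a) p t)
      (fun a => match a with
                | O => 0
                | S O => rho t * Sfun p (S q - a) t
                | S (S a' as b) => / t * Hfun b (q - b) p t
                end)).
    + apply is_derive_0.
    + intros f g u v. apply is_derive_Rplus.
    + intros a Ha. apply in_seq in Ha. destruct a as [|[|a]]; [lia| |].
      * now apply is_derive_Hfun_1.
      * rewrite Rmult_comm. now apply is_derive_Hfun_SS.
  - cbn [seq]. rewrite lsum_cons, <- seq_shift, lsum_map, Sfun_S.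
    unfold Rdiv. rewrite (Rmult_comm _ (/ t)), <- lsum_scal.
    f_equal.
    + now replace (S q - 1)%nat with q by lia.
    + apply lsum_ext. intros a Ha. apply in_seq in Ha. now destruct a; [lia|].
Qed.

Lemma Sfun_vanishing (p q : nat) : vanishing (Sfun (S p) q).
Proof.
  apply (lsum_ind2 (fun f _ => vanishing f) (fun a t => Hfun a (q - a) p t) (fun _ => 0)).
  - apply vanishing_zero.
  - intros f g _ _. apply vanishing_plus.
  - intros a Ha. apply in_seq in Ha. apply Hfun_vanishing. lia.
Qed.

Lemma Sfun_at_left_1 (p q : nat) :
  filterlim (Sfun (S p) q) (at_left 1)
    (locally (lsum (fun a => Hlim a (q - a) p) (seq 1 q))).
Proof.
  apply flim_lsum. intros a Ha. apply in_seq in Ha. apply Hfun_at_left_1. lia.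
Qed.

Lemma Afun_nil (t : R) : Afun [] t = 1.
Proof.
  assert (H : forall n, 1 = sum_n (fun k => coef [] k * (t ^ 2) ^ k) n).
  { induction n as [|n IH].
    - rewrite sum_n_zero. simpl. ring.
    - rewrite sum_n_succ, <- IH. simpl. ring. }
  unfold Afun. replace (PSeries (coef []) _) with 1; [simpl; ring|].
  symmetry. apply is_series_unique.
  exact (filterlim_ext _ _ H (filterlim_const _)).
Qed.

(** * Primitives from 0 and the values of [W] *)

(** Closed form of the iterated primitive [U^k_p]; its derivative and its limit at 0 are checked
    below. *)
Definition Ufun (k p : nat) : R -> R := conv (Sfun p) (k + p - 1).

Lemma Ufun_0 (k : nat) (t : R) : Ufun k 0 t = ell (k - 1) t.
Proof.
  unfold Ufun. rewrite conv_head by reflexivity.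
  unfold Sfun. cbn [sumc Nat.eqb barhead length pow].
  rewrite Afun_nil, Nat.add_0_r. ring.
Qed.

Lemma is_derive_Ufun (k p : nat) (t : R) :
  (1 <= k)%nat -> 0 < t < 1 -> is_derive (Ufun k (S p)) t (rho t * Ufun k p t).
Proof.
  intros Hk Ht. unfold Ufun.
  replace (k + S p - 1)%nat with (S (k + p - 1)) by lia.
  eapply is_derive_eq.
  - apply (is_derive_conv _ _
      (fun i => match i with O => 0 | S j => rho t * Sfun p j t end) 0); [lra| |].
    (* [Sfun (S p) 0] is an empty sum, so the family starts with the zero function. *)
    + eapply is_derive_eq; [apply is_derive_0|]. field. lra.
    + intros i. now apply is_derive_Sfun_S.
  - cbn [conv]. rewrite conv_scal. field. lra.
Qed.

Lemma Ufun_at_right_0 (k p : nat) : filterlim (Ufun k (S p)) (at_right 0) (locally 0).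
Proof. apply conv_at_right_0. intros i. apply Sfun_vanishing. Qed.

(** A finite limit suffices: in [VUfun] it is multiplied by a [Vfun] factor that tends to 0. *)
Lemma Ufun_at_left_1 (k p : nat) :
  exists u, filterlim (Ufun k (S p)) (at_left 1) (locally u).
Proof. eexists. apply conv_at_left_1. intros i. apply Sfun_at_left_1. Qed.

(** Closed form of the primitive from 0 of [rho ell_(m-1) U^k_p], with [c] the last part of a
    composition. At 1 each convolution reduces to its last function, with the raised exponent
    [c + m - 1]. *)
Definition Qfun (k m p : nat) (t : R) : R :=
  lsum (fun c => Binomial.C (c + m - 2) (m - 1) *
    conv (fun i => Hfun (S i) (k + p - c) p) (c + m - 2) t) (seq 1 (k + p)).

(* The binomial weight in [W] is what splits the power of [- ln t] into the two factors
   [ell_(m-1)] and [ell_(c-1)]. *)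
Lemma C_mult_ell (c m : nat) (t : R) :
  (1 <= c)%nat -> (1 <= m)%nat ->
  Binomial.C (c + m - 2) (m - 1) * ell (c + m - 2) t = ell (m - 1) t * ell (c - 1) t.
Proof.
  intros Hc Hm. unfold Binomial.C, ell.
  replace (c + m - 2 - (m - 1))%nat with (c - 1)%nat by lia.
  replace (c + m - 2)%nat with ((m - 1) + (c - 1))%nat by lia.
  rewrite pow_add. field. repeat split; apply INR_fact_neq_0.
Qed.

Lemma is_derive_Qfun (k m p : nat) (t : R) :
  (1 <= k)%nat -> (1 <= m)%nat -> 0 < t < 1 ->
  is_derive (Qfun k m p) t (rho t * ell (m - 1) t * Ufun k p t).
Proof.
  intros Hk Hm Ht. eapply is_derive_eq.
  - apply (lsum_ind2 (fun f v => is_derive f t v)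
      (fun c t => Binomial.C (c + m - 2) (m - 1) *
         conv (fun i => Hfun (S i) (k + p - c) p) (c + m - 2) t)
      (fun c => Binomial.C (c + m - 2) (m - 1) *
         (rho t * Sfun p (k + p - c) t * ell (c + m - 2) t))).
    + apply is_derive_0.
    + intros f g u v. apply is_derive_Rplus.
    + intros c _. apply is_derive_scal. eapply is_derive_eq.
      * apply (is_derive_conv _ (fun i => Hfun (S i) (k + p - c) p)
          (fun i => match i with O => rho t * Sfun p (k + p - c) t | S _ => 0 end) 0); [lra| |].
        -- eapply is_derive_eq; [now apply is_derive_Hfun_1|]. field. lra.
        -- intros i. eapply is_derive_eq; [now apply is_derive_Hfun_SS|]. ring.
      * rewrite conv_head by reflexivity. field. lra.
  - unfold Ufun. rewrite conv_lsum.
    replace (S (k + p - 1)) with (k + p)%nat by lia.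
    rewrite <- lsum_scal. apply lsum_ext. intros c Hc. apply in_seq in Hc.
    transitivity (rho t * Sfun p (k + p - c) t *
      (Binomial.C (c + m - 2) (m - 1) * ell (c + m - 2) t)); [ring|].
    rewrite C_mult_ell by lia. ring.
Qed.

Lemma Qfun_at_right_0 (k m p : nat) : filterlim (Qfun k m p) (at_right 0) (locally 0).
Proof.
  replace 0 with (lsum (fun c => Binomial.C (c + m - 2) (m - 1) * 0) (seq 1 (k + p))) at 2
    by (apply lsum_zero; intros; ring).
  apply flim_lsum. intros c _. apply flim_scal, conv_at_right_0.
  intros i. apply Hfun_vanishing. lia.
Qed.

Lemma Hlim_sumc (a n p : nat) :
  Hlim a n p = (-1) ^ S p * sumc (fun l => Tval (rev ((a, true) :: unbarred l))) n p.
Proof.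
  unfold Hlim. rewrite <- sumc_scal. apply sumc_ext. now intros l ->.
Qed.

Lemma Qfun_at_left_1 (k m p : nat) :
  (1 <= m)%nat ->
  filterlim (Qfun k m p) (at_left 1) (locally ((-1) ^ S p * W m (k + p) (S p))).
Proof.
  intros Hm. rewrite W_sumc, <- lsum_scal.
  apply flim_lsum. intros c Hc. apply in_seq in Hc.
  rewrite <- Rmult_assoc, (Rmult_comm ((-1) ^ S p)), Rmult_assoc.
  apply flim_scal. rewrite <- Hlim_sumc.
  replace (c + m - 1)%nat with (S (c + m - 2)) by lia.
  apply (conv_at_left_1 _ (fun i => Hfun (S i) (k + p - c) p)
    (fun i => Hlim (S i) (k + p - c) p)).
  intros i. apply Hfun_at_left_1. lia.
Qed.

(** * The involution exchanging 0 and 1 *)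

Definition dual (t : R) : R := (1 - t) / (1 + t).

Lemma dual_range (t : R) : 0 < t < 1 -> 0 < dual t < 1.
Proof.
  intros Ht. unfold dual. split; [apply Rdiv_lt_0_compat; lra|].
  apply Rmult_lt_reg_r with (1 + t); [lra|].
  replace ((1 - t) / (1 + t) * (1 + t)) with (1 - t) by (field; lra). lra.
Qed.

Lemma is_derive_dual (t : R) : 0 < t < 1 -> is_derive dual t (- (2 / (1 + t) ^ 2)).
Proof. intros Ht. unfold dual. auto_derive; [lra|]. field. lra. Qed.

Lemma dual_continuous (t : R) : 0 <= t -> filterlim dual (locally t) (locally (dual t)).
Proof.
  intros Ht. apply continuity_pt_filterlim, derivable_continuous_pt.
  exists (- (2 / (1 + t) ^ 2)). apply is_derive_Reals.
  unfold dual. auto_derive; [lra|]. field. lra.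
Qed.

Lemma filterlim_dual_at_right_0 : filterlim dual (at_right 0) (at_left 1).
Proof.
  intros P HP.
  assert (H : filterlim dual (at_right 0) (locally 1)).
  { replace 1 with (dual 0) by (unfold dual; field).
    eapply filterlim_filter_le_1; [apply filter_le_within|].
    apply dual_continuous. lra. }
  specialize (H _ HP). unfold filtermap in *.
  generalize (filter_and _ _ H at_right_0_lt_1). apply filter_imp.
  intros t [H1 H2]. apply H1. now apply dual_range.
Qed.

Lemma filterlim_dual_at_left_1 : filterlim dual (at_left 1) (at_right 0).
Proof.
  intros P HP.
  assert (H : filterlim dual (at_left 1) (locally 0)).
  { replace 0 with (dual 1) by (unfold dual; field).
    eapply filterlim_filter_le_1; [apply filter_le_within|].
    apply dual_continuous. lra. }
  specialize (H _ HP). unfold filtermap in *.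
  generalize (filter_and _ _ H at_left_1_pos). apply filter_imp.
  intros t [H1 H2]. apply H1. now apply dual_range.
Qed.

Lemma is_derive_comp_dual (f : R -> R) (t d : R) :
  0 < t < 1 -> is_derive f (dual t) d ->
  is_derive (fun t => f (dual t)) t (- (2 / (1 + t) ^ 2) * d).
Proof.
  intros Ht Hf. exact (is_derive_comp f dual t _ _ Hf (is_derive_dual t Ht)).
Qed.

Lemma pos_repeat_1 (b : bool) (n : nat) : pos_entries (repeat (1%nat, b) n).
Proof. induction n; simpl; constructor; simpl; [lia|easy]. Qed.

(* Under [t -> (1 - t) / (1 + t)] the form [2 dt / (1 - t^2)] becomes [- dt / t]. *)
Lemma Afun_ones_dual (n : nat) (t : R) :
  0 < t < 1 -> Afun (repeat (1%nat, false) n) (dual t) = ell n t.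
Proof.
  revert t. induction n as [|n IH]; intros t Ht.
  - cbn [repeat]. now rewrite Afun_nil, ell_0.
  - cut (Afun (repeat (1%nat, false) (S n)) (dual t) + -1 * ell (S n) t = 0); [lra|].
    revert t Ht.
    (* The constant is found at 1, where [dual t] tends to 0 and both terms vanish. *)
    apply (zero_derive_limit (at_left 1)
      (fun t => Afun (repeat (1%nat, false) (S n)) (dual t) + -1 * ell (S n) t)).
    + intros t Ht. eapply is_derive_eq.
      * apply is_derive_Rplus.
        -- apply is_derive_comp_dual; [easy|].
           apply (is_derive_Afun_1_false (repeat (1%nat, false) n));
             [apply pos_repeat_1|now apply dual_range].
        -- apply is_derive_scal, is_derive_ell_S. lra.
      * rewrite IH by easy. unfold dual. field. repeat split; nra.
    + apply at_left_1_pos.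
    + replace 0 with (0 + -1 * 0) by ring. apply flim_plus.
      * eapply filterlim_comp; [apply filterlim_dual_at_left_1|].
        apply vanishing_lim, Afun_vanishing; [apply pos_repeat_1|easy].
      * apply flim_scal, ell_S_at_left_1.
Qed.

(** * Primitives from 1 *)

(** For [p > 0] this is [Aseq k p] reversed. For [p = 0] it is the list whose function, composed
    with [dual], is [ell (k - 1)]. *)
Definition Vlist (k p : nat) : list entry :=
  match p with
  | O => repeat (1%nat, false) (k - 1)
  | S p' => (1%nat, true) :: repeat (1%nat, false) p' ++ rev (Defs.pre k)
  end.

Lemma rev_Vlist_S (k p : nat) : rev (Vlist k (S p)) = Aseq k (S p).
Proof.
  unfold Vlist, Aseq. cbn [rev].
  rewrite rev_app_distr, rev_involutive, rev_repeat, <- app_assoc.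
  now replace (S p - 1)%nat with p by lia.
Qed.

(** For [p > 0] the flip bars the leading 1. For [p = 0] it removes the bar of [pre k] and leaves
    [k - 1] plain ones, in accordance with the convention for [k = 1]. *)
Lemma flip_Vlist_tail (k p : nat) :
  (1 <= k)%nat -> flip (repeat (1%nat, false) p ++ rev (Defs.pre k)) = Vlist k p.
Proof.
  intros Hk. destruct p as [|p]; [|reflexivity].
  destruct k as [|[|k]]; [lia|reflexivity|].
  unfold Defs.pre. cbn [Nat.eqb repeat app Vlist].
  rewrite rev_app_distr, rev_repeat.
  replace (S (S k) - 2)%nat with k by lia.
  now replace (S (S k) - 1)%nat with (S k) by lia.
Qed.

Lemma pos_pre (k : nat) : pos_entries (rev (Defs.pre k)).
Proof.
  apply Forall_rev. unfold Defs.pre. destruct (Nat.eqb k 1); [constructor|].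
  apply Forall_app. split; [apply pos_repeat_1|]. now constructor.
Qed.

Lemma pos_Vlist_tail (k p : nat) : pos_entries (repeat (1%nat, false) p ++ rev (Defs.pre k)).
Proof. apply Forall_app. split; [apply pos_repeat_1|apply pos_pre]. Qed.

Definition Vfun (k p : nat) (t : R) : R := (-1) ^ p * Afun (Vlist k p) (dual t).

Lemma Vfun_0 (k : nat) (t : R) : 0 < t < 1 -> Vfun k 0 t = ell (k - 1) t.
Proof. intros Ht. unfold Vfun. cbn [Vlist]. rewrite Afun_ones_dual by easy. simpl. ring. Qed.

(** Invariance of [rho dt] up to sign: [4 / ((1+t)^2 + (1-t)^2) = 2 / (1+t^2)]. *)
Lemma is_derive_Vfun (k p : nat) (t : R) :
  (1 <= k)%nat -> 0 < t < 1 -> is_derive (Vfun k (S p)) t (- rho t * Vfun k p t).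
Proof.
  intros Hk Ht. eapply is_derive_eq.
  - apply is_derive_scal. apply is_derive_comp_dual; [easy|].
    apply is_derive_Afun_1_true; [apply pos_Vlist_tail|now apply dual_range].
  - rewrite flip_Vlist_tail by easy. unfold Vfun, rho, dual. simpl. field.
    repeat split; nra.
Qed.

Lemma Vfun_at_left_1 (k p : nat) : filterlim (Vfun k (S p)) (at_left 1) (locally 0).
Proof.
  rewrite <- (Rmult_0_r ((-1) ^ S p)). apply flim_scal.
  eapply filterlim_comp; [apply filterlim_dual_at_left_1|].
  apply vanishing_lim, Afun_vanishing; [|easy].
  apply pos_cons; [easy|apply pos_Vlist_tail].
Qed.

Lemma Vfun_at_right_0 (k p : nat) :
  filterlim (Vfun k (S p)) (at_right 0) (locally ((-1) ^ S p * Tval (Aseq k (S p)))).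
Proof.
  apply flim_scal. eapply filterlim_comp; [apply filterlim_dual_at_right_0|].
  rewrite <- rev_Vlist_S. apply Afun_at_left_1.
  apply pos_cons; [easy|apply pos_Vlist_tail].
Qed.

(** * Repeated integration by parts *)

(** Boundary terms of the integrations by parts that trade primitives of [U^k] for those of [V^m].
    They vanish at 0 through [U] and at 1 through [V]. *)
Definition VUfun (k m p : nat) (t : R) : R :=
  lsum (fun i => Vfun m i t * Ufun k (S p - i) t) (seq 1 p).

(** The analogue for two families from 1. Both derivatives carry the same sign, so alternating signs
    are needed to telescope; the limit at 0 yields the products of T-values. *)
Definition VVfun (k m p : nat) (t : R) : R :=
  lsum (fun j => (-1) ^ (j - 1) * (Vfun k j t * Vfun m (S p - j) t)) (seq 1 p).

Lemma is_derive_VUfun (k m p : nat) (t : R) :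
  (1 <= k)%nat -> (1 <= m)%nat -> 0 < t < 1 ->
  is_derive (VUfun k m p) t
    (rho t * (Vfun m p t * Ufun k 0 t - Vfun m 0 t * Ufun k p t)).
Proof.
  intros Hk Hm Ht.
  set (g := fun i => Vfun m i t * Ufun k (p - i) t).
  eapply is_derive_eq.
  - apply (lsum_ind2 (fun f v => is_derive f t v) (fun i t => Vfun m i t * Ufun k (S p - i) t)
      (fun i => rho t * (g i - g (i - 1)%nat))).
    + apply is_derive_0.
    + intros f f' u v. apply is_derive_Rplus.
    + intros [|i] Hi; apply in_seq in Hi; [lia|].
      replace (S p - S i)%nat with (S (p - S i)) by lia.
      eapply is_derive_eq.
      * apply is_derive_Rmult; [now apply is_derive_Vfun|now apply is_derive_Ufun].
      * unfold g. replace (S i - 1)%nat with i by lia.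
        replace (p - i)%nat with (S (p - S i)) by lia. ring.
  - rewrite lsum_scal, lsum_telescope. unfold g. now rewrite Nat.sub_diag, Nat.sub_0_r.
Qed.

Lemma is_derive_VVfun (k m p : nat) (t : R) :
  (1 <= k)%nat -> (1 <= m)%nat -> 0 < t < 1 ->
  is_derive (VVfun k m p) t
    (rho t * ((-1) ^ p * (Vfun k p t * Vfun m 0 t) - Vfun k 0 t * Vfun m p t)).
Proof.
  intros Hk Hm Ht.
  set (g := fun i => (-1) ^ i * (Vfun k i t * Vfun m (p - i) t)).
  eapply is_derive_eq.
  - apply (lsum_ind2 (fun f v => is_derive f t v)
      (fun j t => (-1) ^ (j - 1) * (Vfun k j t * Vfun m (S p - j) t))
      (fun i => rho t * (g i - g (i - 1)%nat))).
    + apply is_derive_0.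
    + intros f f' u v. apply is_derive_Rplus.
    + intros [|i] Hi; apply in_seq in Hi; [lia|].
      replace (S p - S i)%nat with (S (p - S i)) by lia.
      replace (S i - 1)%nat with i by lia.
      eapply is_derive_eq.
      * apply is_derive_scal, is_derive_Rmult; now apply is_derive_Vfun.
      * unfold g.
        replace (p - i)%nat with (S (p - S i)) by lia. simpl pow. ring.
  - rewrite lsum_scal, lsum_telescope. unfold g. rewrite Nat.sub_diag, Nat.sub_0_r.
    simpl pow. ring.
Qed.

Lemma VUfun_at_right_0 (k m p : nat) : filterlim (VUfun k m p) (at_right 0) (locally 0).
Proof.
  replace 0 with (lsum (fun i => (-1) ^ i * Tval (Aseq m i) * 0) (seq 1 p)) at 2
    by (apply lsum_zero; intros; ring).
  apply flim_lsum. intros [|i] Hi; apply in_seq in Hi; [lia|].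
  replace (S p - S i)%nat with (S (p - S i)) by lia.
  apply flim_mult; [apply Vfun_at_right_0|apply Ufun_at_right_0].
Qed.

Lemma VUfun_at_left_1 (k m p : nat) : filterlim (VUfun k m p) (at_left 1) (locally 0).
Proof.
  rewrite <- (lsum_zero (fun _ => 0) (seq 1 p)) by easy.
  apply flim_lsum. intros [|i] Hi; apply in_seq in Hi; [lia|].
  replace (S p - S i)%nat with (S (p - S i)) by lia.
  destruct (Ufun_at_left_1 k (p - S i)) as [u Hu].
  rewrite <- (Rmult_0_l u). apply flim_mult; [apply Vfun_at_left_1|exact Hu].
Qed.

Lemma VVfun_at_left_1 (k m p : nat) : filterlim (VVfun k m p) (at_left 1) (locally 0).
Proof.
  rewrite <- (lsum_zero (fun j => (-1) ^ (j - 1) * (0 * 0)) (seq 1 p)) by (intros; ring).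
  apply flim_lsum. intros [|i] Hi; apply in_seq in Hi; [lia|].
  replace (S p - S i)%nat with (S (p - S i)) by lia.
  apply flim_scal, flim_mult; apply Vfun_at_left_1.
Qed.

Lemma VVfun_at_right_0 (k m p : nat) :
  filterlim (VVfun k m p) (at_right 0) (locally ((-1) ^ S p *
    lsum (fun j => (-1) ^ (j - 1) * Tval (Aseq k j) * Tval (Aseq m (S p - j))) (seq 1 p))).
Proof.
  rewrite <- lsum_scal. apply flim_lsum.
  intros [|i] Hi; apply in_seq in Hi; [lia|].
  (* The global sign splits into the signs carried by the two [Vfun] limits. *)
  replace ((-1) ^ S p) with ((-1) ^ S i * (-1) ^ (S p - S i))
    by (rewrite <- pow_add; f_equal; lia).
  replace (S p - S i)%nat with (S (p - S i)) by lia.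
  match goal with |- filterlim _ _ (locally (?a * ?b * (?c * ?x * ?y))) =>
    replace (a * b * (c * x * y)) with (c * ((a * x) * (b * y))) by ring end.
  apply flim_scal, flim_mult; apply Vfun_at_right_0.
Qed.

Theorem theorem1p3 (k m r : nat) :
  (1 <= k)%nat -> (1 <= m)%nat -> (1 <= r)%nat ->
  W m (k + r - 1) r + (-1) ^ r * W k (m + r - 1) r =
  lsum (fun j => (-1) ^ (j - 1) * Tval (Aseq k j) * Tval (Aseq m (r - j)))
       (seq 1 (r - 1)).
Proof.
  intros Hk Hm Hr. destruct r as [|p]; [lia|].
  replace (k + S p - 1)%nat with (k + p)%nat by lia.
  replace (m + S p - 1)%nat with (m + p)%nat by lia.
  replace (S p - 1)%nat with p by lia.
  set (s := (-1) ^ S p).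
  set (T := lsum _ _).
  assert (Hs : s * s = 1) by apply sqr_pow_minus_one.
  (* Multiplied by [s], both [W] terms appear with the sign that [Qfun] has at 1. *)
  cut (s * T = s * W m (k + p) (S p) + s * (s * W k (m + p) (S p))).
  { intros E. apply (f_equal (Rmult s)) in E.
    rewrite Rmult_plus_distr_l, <- !(Rmult_assoc s s), Hs in E. lra. }
  (* The first two groups have derivatives [rho V^m_p ell_(k-1)] and [s rho V^k_p ell_(m-1)]. Since
     [s = - (-1)^p], the derivative of [VVfun] cancels both. *)
  apply (zero_derive_limits_eq (fun t =>
    (Qfun k m p t + VUfun k m p t) + s * (Qfun m k p t + VUfun m k p t) + VVfun k m p t)).
  - intros t Ht. eapply is_derive_eq.
    + apply is_derive_Rplus; [apply is_derive_Rplus|now apply is_derive_VVfun].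
      * apply is_derive_Rplus; [now apply is_derive_Qfun|now apply is_derive_VUfun].
      * apply is_derive_scal, is_derive_Rplus;
          [now apply is_derive_Qfun|now apply is_derive_VUfun].
    + rewrite !Vfun_0, !Ufun_0 by easy. unfold s. simpl pow. ring.
  - replace (s * T) with ((0 + 0) + s * (0 + 0) + s * T) by ring.
    apply flim_plus; [apply flim_plus|apply VVfun_at_right_0].
    + apply flim_plus; [apply Qfun_at_right_0|apply VUfun_at_right_0].
    + apply flim_scal, flim_plus; [apply Qfun_at_right_0|apply VUfun_at_right_0].
  - replace (s * W m (k + p) (S p) + s * (s * W k (m + p) (S p))) with
      ((s * W m (k + p) (S p) + 0) + s * (s * W k (m + p) (S p) + 0) + 0) by ring.
    apply flim_plus; [apply flim_plus|apply VVfun_at_left_1].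
    + apply flim_plus; [now apply Qfun_at_left_1|apply VUfun_at_left_1].
    + apply flim_scal, flim_plus; [now apply Qfun_at_left_1|apply VUfun_at_left_1].
Qed.
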